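(* Let $d\ge 1$, let $\nu$ be a symmetric Lévy measure on $\mathbb{R}^d$, let $\alpha\in(0,2)$, and suppose there is $c_0>0$ such that $\Phi(\xi)\ge c_0|\xi|^{\alpha}$ for all $|\xi|>1$. Suppose there exist a set $A\subset\mathbb{R}^d$, constants $\gamma\in[1,d]$, $c_1,c_2>0$ and a bounded function $\underline q:(0,\infty)\to(0,\infty)$ such that $$\nu(B(x,r))\ge c_1\,r^{\gamma}|x|^{-\alpha-\gamma}\,\underline q(|x|)\quad\text{for all } x\in A,\ r>0,$$ $$\nu(B(0,r)^c)\le c_2\,r^{-\alpha}\quad\text{for all } r\in(0,1).$$ Then there exists a constant $C>0$ such that $$p_t(x)\ge C\min\left(t^{-d/\alpha},\ t^{1+\frac{\gamma-d}{\alpha}}|x|^{-\alpha-\gamma}\,\underline q(|x|)\right)\quad\text{for all } x\in A,\ t\in(0,1).$$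
   Context: $B(x,r)$ is the open ball of center $x$ and radius $r$. All sets, functions and measures are Borel. $\Phi(\xi)=\int_{\mathbb{R}^d}(1-\cos(\xi\cdot y))\,\nu(dy)$, and $\{P_t,\ t\ge0\}$ is the convolution semigroup of probability measures on $\mathbb{R}^d$ with Fourier transform $\mathcal{F}(P_t)(\xi)=\exp(-t\Phi(\xi))$. Under the assumption $\Phi(\xi)\ge c_0|\xi|^\alpha$ for $|\xi|>1$, for every $t>0$ the measure $P_t$ is absolutely continuous with a smooth bounded density, denoted $p_t$. Constants do not depend on $x,t$. If $0\in A$, then at $x=0$ the first displayed hypothesis is regarded as satisfied and the minimum in the conclusion is read as $t^{-d/\alpha}$. *)

(* Defs.v *)
From HB Require Import structures.
From mathcomp Require Import all_boot all_order all_algebra.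
From mathcomp Require Import complex.
From mathcomp Require Import all_classical all_reals all_analysis.
From mathcomp Require Import measurable_realfun.

Set Implicit Arguments.
Unset Strict Implicit.
Unset Printing Implicit Defensive.

Import Order.TTheory GRing.Theory Num.Theory.
Import numFieldNormedType.Exports.

Local Open Scope classical_set_scope.
Local Open Scope ring_scope.

(* R^d is 'rV[R]_d with its Borel sigma-algebra. The library's norm `|x| on
   'rV[R]_d is the sup norm: it gives the same topology, but lengths and balls
   below are Euclidean. *)
HB.instance Definition _ (R : realType) (d : nat) :=
  @isMeasurable.Build (sigma_display (@open 'rV[R]_d)) 'rV[R]_d
    <<s @open 'rV[R]_d >> (@sigma_algebra0 _ setT _) (@sigma_algebraC _ _)
    (@sigma_algebra_bigcup _ setT _).

Section borel_row_vectors.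
Context {R : realType}.

Lemma open_measurable_rV d (U : set 'rV[R]_d) : open U -> measurable U.
Proof. exact: sub_sigma_algebra. Qed.

Lemma measurable_coord d (i : 'I_d) :
  measurable_fun [set: 'rV[R]_d] (fun v => v ord0 i : measurableTypeR R).
Proof.
apply: (measurability _ (RGenOpens.measurableE R)) => _ [_ [x [y ->]] <-].
rewrite setTI; apply: open_measurable_rV.
by apply: open_comp (interval_open _ _) => // v _; exact: coord_continuous.
Qed.

Lemma measurable_fun_rV d' (T : measurableType d') d (f : T -> 'rV[R]_d) :
  (forall i, measurable_fun setT (fun t => f t ord0 i : measurableTypeR R)) ->
  measurable_fun setT f.
Proof.
move=> mf; apply: (measurability (@open 'rV[R]_d)) => // _ [U oU <-].
rewrite setTI.
pose c (q : 'rV[rat]_d * nat) : 'rV[R]_d := map_mx ratr q.1.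
pose B q := ball (c q) (q.2.+1%:R^-1 : R).
have -> : U = \bigcup_q (if `[< B q `<=` U >] then B q else set0).
  apply/seteqP; split => [x Ux|x [q _]]; last first.
    by case: ifPn => // /asboolP; exact.
  have /nbhs_ballP[e /= e0 eU] : nbhs x U by exact: open_nbhs_nbhs.
  have e20 : 0 < e / 2 by rewrite divr_gt0.
  have [k ke] : exists k, k.+1%:R^-1 < e / 2.
    have [k] := @ltr_add_invr R 0 (e / 2) e20.
    by rewrite add0r; exists k.
  have k0 : 0 < k.+1%:R^-1 :> R by rewrite invr_gt0.
  have /choice[g gP] i : exists q : rat, ball (x ord0 i) (k.+1%:R^-1 : R) (ratr q).
    have [|q] := @rat_in_itvoo R (x ord0 i - k.+1%:R^-1) (x ord0 i + k.+1%:R^-1).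
      by rewrite ltrD2l gtrN.
    by exists q; rewrite ball_itv.
  pose q : 'rV[rat]_d * nat := (\row_i g i, k).
  have Bx : B q x.
    by split => // i j; rewrite !mxE ord1; exact/ball_sym/gP.
  exists q => //; case: ifPn => // /asboolP[] y Bqy; apply: eU.
  have : ball x (k.+1%:R^-1 + k.+1%:R^-1) y by apply: ball_triangle Bqy; exact/ball_sym.
  by apply: le_ball; rewrite [leRHS]splitr lerD// ltW.
rewrite preimage_bigcup; apply: countable_bigcupT_measurable => // q.
case: ifPn => _; last by rewrite preimage_set0.
have -> : f @^-1` B q = \bigcap_(i in [set: 'I_d])
    (fun t => f t ord0 i) @^-1` ball (c q ord0 i) (q.2.+1%:R^-1 : R).
  apply/seteqP; split => [t [_ Bt] i _|t Bt]; first exact: Bt.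
  by split => [|i j]; [rewrite invr_gt0|rewrite ord1; exact: Bt].
apply: fin_bigcap_measurable => // i _.
rewrite -[X in measurable X]setTI; apply: mf => //.
apply: open_measurable; apply: ball_open; rewrite invr_gt0.
Qed.

End borel_row_vectors.

Section lebesgue_measure_rV.
Context {R : realType}.
Local Open Scope ereal_scope.

Definition cons_rV d (z : measurableTypeR R * 'rV[R]_d) : 'rV[R]_d.+1 :=
  row_mx (z.1%:M : 'rV_1) z.2.

Lemma measurable_cons_rV d : measurable_fun setT (@cons_rV d).
Proof.
apply: measurable_fun_rV => i; rewrite -[d.+1]/(1 + d)%N in i *.
have [j ->|j ->] := split_ordP i.
  rewrite (_ : (fun _ => _) = fst); first exact: measurable_fst.
  by apply/funext => z; rewrite /cons_rV row_mxEl (ord1 j) [LHS]mxE eqxx mulr1n.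
rewrite (_ : (fun _ => _) = (fun v : 'rV_d => v ord0 j) \o snd).
  exact: measurableT_comp (measurable_coord j) measurable_snd.
by apply/funext => z; rewrite /cons_rV row_mxEr.
Qed.

Definition cons_measure d (m : {sigma_finite_measure set 'rV[R]_d -> \bar R}) :=
  pushforward (lebesgue_measure \x m) (@cons_rV d).

Section cons_measure.
Context d (m : {sigma_finite_measure set 'rV[R]_d -> \bar R}).

Let cons_measure0 : cons_measure m set0 = 0.
Proof. by rewrite /cons_measure /pushforward preimage_set0 measure0. Qed.

Let cons_measure_ge0 A : 0 <= cons_measure m A.
Proof. by apply: integral_ge0 => x _; exact: measure_ge0. Qed.

Let cons_measure_sigma_additive : semi_sigma_additive (cons_measure m).
Proof.
move=> F mF tF mUF; rewrite /cons_measure /pushforward preimage_bigcup.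
have mcF n : measurable (@cons_rV d @^-1` F n).
  by rewrite -[X in measurable X]setTI; exact: measurable_cons_rV.
apply: measure_semi_sigma_additive => //; last exact: bigcup_measurable.
apply/trivIsetP => /= i j _ _ ij; rewrite -preimage_setI.
by move/trivIsetP : tF => /(_ _ _ _ _ ij) ->//; rewrite preimage_set0.
Qed.

HB.instance Definition _ := isMeasure.Build _ _ _ (cons_measure m)
  cons_measure0 cons_measure_ge0 cons_measure_sigma_additive.

Let cons_measure_sigma_finite : sigma_finite setT (cons_measure m).
Proof.
have /sigma_finiteP[G [TG ndG Goo]] := sigma_finiteT (@lebesgue_measure R).
have /sigma_finiteP[H [TH ndH Hoo]] := sigma_finiteT m.
pose F n := G n `*` H n.
have FT : [set: measurableTypeR R * 'rV[R]_d] = \bigcup_n F n.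
  apply/seteqP; split => // -[x v] _.
  have [n _ Gx] : (\bigcup_n G n) x by rewrite -TG.
  have [k _ Hv] : (\bigcup_n H n) v by rewrite -TH.
  exists (maxn n k) => //; split => /=.
    by move: Gx; exact/subsetPset/ndG/leq_maxl.
  by move: Hv; exact/subsetPset/ndH/leq_maxr.
have mF n : measurable (F n) /\ (lebesgue_measure \x m) (F n) < +oo.
  have [mG Gn] := Goo n; have [mH Hn] := Hoo n.
  split; first exact: measurableX.
  by rewrite product_measure1E// lte_mul_pinfty// ge0_fin_numE.
pose g (v : 'rV[R]_d.+1) : measurableTypeR R * 'rV[R]_d :=
  (v ord0 (ord0 : 'I_d.+1), rsubmx (v : 'rV_(1 + d))).
have gK z : g (cons_rV z) = z.
  case: z => x v; congr pair; last exact: row_mxKr.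
  rewrite [LHS](_ : _ = cons_rV (x, v) ord0 (lshift d (ord0 : 'I_1))).
    by apply: (etrans (row_mxEl _ _ _ _)); rewrite [LHS]mxE eqxx mulr1n.
  by congr (cons_rV _ _ _); exact/val_inj.
have mg : measurable_fun setT g.
  apply: measurable_fun_pair; first exact: measurable_coord.
  apply: measurable_fun_rV => i.
  rewrite (_ : (fun _ => _) = (fun v : 'rV[R]_d.+1 => v ord0 (rshift 1 i))).
    exact: measurable_coord.
  by apply/funext => v; rewrite mxE.
exists (fun n => g @^-1` F n); first by rewrite -preimage_bigcup -FT preimage_setT.
move=> n; have [mFn Fn] := mF n; split.
  by rewrite -[X in measurable X]setTI; exact: mg.
rewrite /cons_measure /pushforward (_ : _ @^-1` _ = F n)//.
by apply/seteqP; split => z /=; rewrite gK.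
Qed.

HB.instance Definition _ := Measure_isSigmaFinite.Build _ _ _ (cons_measure m)
  cons_measure_sigma_finite.

End cons_measure.

(* d-dimensional Lebesgue measure: the image of the product of d copies of the
   one-dimensional one. *)
Fixpoint lebesgue_rV d : {sigma_finite_measure set 'rV[R]_d -> \bar R} :=
  match d with
  | 0 => \d_(0%R : 'rV[R]_0)
  | d'.+1 => cons_measure (lebesgue_rV d')
  end.

End lebesgue_measure_rV.

Section levy_processes.
Context {R : realType} {d : nat}.
Implicit Types (x y xi : 'rV[R]_d) (nu : {measure set 'rV[R]_d -> \bar R}).

Definition dotp x y : R := \sum_(i < d) x ord0 i * y ord0 i.

Definition enorm x : R := Num.sqrt (dotp x x).

Definition eball x (r : R) : set 'rV[R]_d := [set y | enorm (y - x) < r].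

Definition levy_measure nu : Prop :=
  nu [set 0] = 0%E /\
  (\int[nu]_y (Num.min 1 (enorm y ^+ 2))%:E < +oo)%E.

Definition symmetric_measure nu : Prop :=
  forall B : set 'rV[R]_d, measurable B -> nu [set - y | y in B] = nu B.

(* The integral is finite when nu is a Levy measure, so nothing is lost in
   taking it real valued. *)
Definition levy_exponent nu xi : R := \int[nu]_y (1 - cos (dotp xi y)).

Definition fourier (mu : {measure set 'rV[R]_d -> \bar R}) xi : R[i] :=
  Complex (\int[mu]_x cos (dotp xi x)) (\int[mu]_x sin (dotp xi x)).

(* The convolution semigroup (P_t)_{t >= 0} generated by nu; the values of P
   at negative times are irrelevant. *)
Definition levy_semigroup nu (P : R -> probability 'rV[R]_d R) : Prop :=
  (forall s t : R, 0 <= s -> 0 <= t -> forall B : set 'rV[R]_d, measurable B ->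
    P (s + t) B = (\int[P s]_x P t [set y : 'rV[R]_d | B (x + y)%R])%E) /\
  (forall t : R, 0 <= t -> forall xi,
    fourier (P t) xi = (expR (- t * levy_exponent nu xi))%:C%C).

Definition is_density (mu : {measure set 'rV[R]_d -> \bar R})
    (f : 'rV[R]_d -> R) : Prop :=
  [/\ measurable_fun [set: 'rV[R]_d] (f : _ -> measurableTypeR R),
      forall x, 0 <= f x &
      forall B : set 'rV[R]_d, measurable B ->
        mu B = (\int[lebesgue_rV d]_(x in B) (f x)%:E)%E].

Definition iterated_partial (s : seq 'I_d) (f : 'rV[R]_d -> R) :
    'rV[R]_d -> R :=
  foldr (fun i g x => 'D_(delta_mx ord0 i) g x) f s.

(* C^oo: differentiability of an iterated partial derivative makes it
   continuous and makes the next ones meaningful. *)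
Definition smooth (f : 'rV[R]_d -> R) : Prop :=
  forall (s : seq 'I_d) x, differentiable (iterated_partial s f) x.

End levy_processes.

(* Main.v *)
(* The argument stays on the Fourier side. For an integrable weight w, call a
   bounded multiplier g positive definite if the cosine transform of w g is
   nonnegative. This class contains 1 when w(xi) = exp(-e sum_i |xi_i|), whose
   cosine transform is a product of Cauchy kernels, and it is stable under
   nonnegative combinations, bounded pointwise limits and multiplication by the
   cosine transform of a finite measure. Hence it contains exp(-t Phi_r), where
   Phi_r is the exponent of the jumps of size < r, without constructing the
   corresponding semigroup.

   With tau = t^(1/alpha) and r of order tau, write
   exp(-t Phi) = exp(-t lambda) exp(-t Phi_r) exp(t u), where u is the cosine
   transform of nu restricted to the jumps of size >= r and lambda its mass, so
   that t lambda is bounded by the tail hypothesis. Keeping only the first order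
   term t u of exp(t u) bounds the transform of w exp(-t Phi) at x from below by
   a multiple of t tau^(-d) nu(B(x, rho tau)), because the transform of
   w exp(-t Phi_r) is at least a multiple of tau^(-d) near the origin; for |x|
   small compared with tau that last bound, applied to Phi itself, suffices.

   Finally the transform of w exp(-t Phi) is the integral of p_t against a
   Cauchy kernel, which tends to a multiple of p_t(x) as e tends to 0. *)
Require Import Defs.
From mathcomp Require Import all_boot all_order all_algebra.
From mathcomp Require Import all_classical all_reals all_analysis.
From mathcomp Require Import measurable_realfun ring lra.

Set Implicit Arguments.
Unset Strict Implicit.
Unset Printing Implicit Defensive.

Import Order.TTheory GRing.Theory Num.Theory.
Import numFieldNormedType.Exports.

Local Open Scope classical_set_scope.
Local Open Scope ring_scope.

(** * One-dimensional integrals and Lebesgue measure on R^d *)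

Section one_dim.
Context {R : realType}.
Local Notation mu := (@lebesgue_measure R).

Lemma ge0_integral_affine (G : R -> R) (a s : R) : 0 < s ->
  continuous G -> (forall x, 0 <= G x) ->
  (\int[mu]_x (s * G (s * (x - a)))%:E = \int[mu]_x (G x)%:E)%E.
Proof.
move=> s0 cG G0.
pose F x := s * (x - a).
have dF (x : R) : is_derive x (1 : R) F s.
  apply: is_derive_eq.
  by rewrite /GRing.scale/= !(mulr1, subr0, mulr0, addr0).
have F'E : derive1 F = cst s by apply/funext => x; rewrite derive1E derive_val.
rewrite (@increasing_ge0_integration_by_substitutionT _ F G).
- by apply: eq_integral => x _; rewrite F'E /= mulrC.
- by move=> x y xy; rewrite /F ltr_pM2l// ltrD2r.
- by rewrite F'E => x; exact: cst_continuous.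
- by rewrite F'E; exact: is_cvg_cst.
- by rewrite F'E; exact: is_cvg_cst.
- by [].
- apply/cvgrNyPle => A; near=> x.
  rewrite /F -ler_pdivlMl// lerBlDr; near: x; apply: nbhs_ninfty_le; exact: num_real.
- apply/cvgryPge => A; near=> x.
  rewrite /F -ler_pdivrMl// lerBrDr; near: x; apply: nbhs_pinfty_ge; exact: num_real.
- exact: cG.
- by move=> x; exact: G0.
Unshelve. all: by end_near. Qed.

Lemma integralT_oneDsqrV : (\int[mu]_x ((oneDsqr x)^-1)%:E = pi%:E)%E.
Proof.
rewrite ge0_symfun_integralT.
- rewrite -set_itvcy integral0y_oneDsqr -EFinM; congr EFin.
  by rewrite mulrC divfK.
- by move=> x; rewrite /= invr_ge0 (le_trans ler01)// oneDsqr_ge1.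
- exact: continuous_oneDsqrV.
- by move=> x; rewrite /oneDsqr/= sqrrN.
Qed.

Lemma integralT_cauchy (s a : R) : 0 < s ->
  (\int[mu]_x (s / oneDsqr (s * (x - a)))%:E = pi%:E)%E.
Proof.
move=> s0; rewrite -integralT_oneDsqrV.
rewrite -(@ge0_integral_affine (fun x => (oneDsqr x)^-1) a s)//.
exact: continuous_oneDsqrV.
Qed.

(** The summand 1 keeps the integrand nonnegative, so the fundamental theorem of calculus on a
    half-line applies before any integrability is known. The case b = 0 then yields integrability,
    and subtracting it leaves the cosine transform. *)
Lemma integralT_laplace_1Dcos (e b : R) : 0 < e ->
  (\int[mu]_x (expR (- (e * `|x|)) * (1 + cos (b * x)))%:E
    = (2 * (e^-1 + e / (e ^+ 2 + b ^+ 2)))%:E)%E.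
Proof.
move=> e0.
have c0 : 0 < e ^+ 2 + b ^+ 2 by rewrite ltr_wpDr ?sqr_ge0 ?exprn_gt0.
pose f (x : R) := expR (- (e * `|x|)) * (1 + cos (b * x)).
pose g (x : R) := expR (- (e * x)) * (1 + cos (b * x)).
have cf : continuous f.
  move=> x; apply: cvgM.
    apply: continuous_comp; last exact: continuous_expR.
    by apply: cvgN; apply: cvgM; [exact: cvg_cst|exact: norm_continuous].
  apply: cvgD; first exact: cvg_cst.
  apply: continuous_comp; last exact: continuous_cos.
  by apply: cvgM; [exact: cvg_cst|exact: cvg_id].
have f0 x : 0 <= f x.
  by rewrite mulr_ge0 ?expR_ge0// -lerBlDl sub0r cos_geN1.
rewrite ge0_symfun_integralT//; last first.
  by move=> x; rewrite /= normrN mulrN cosN.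
rewrite EFinM; congr (_ * _)%E.
(* Explicit antiderivative of [g] that tends to 0 at infinity. *)
pose F (x : R) := expR (- (e * x)) *
  (- e^-1 + (b * sin (b * x) - e * cos (b * x)) / (e ^+ 2 + b ^+ 2)).
have dF (x : R) : is_derive x (1 : R) F (g x).
  rewrite /F /g.
  apply: is_derive_eq.
  rewrite /GRing.scale/= !(mulr1, subr0, mulr0, addr0).
  field; rewrite gt_eqF//=.
  by rewrite gt_eqF.
rewrite -set_itvcy (@ge0_continuous_FTC2y _ f F 0 0).
- rewrite /F !mulr0 oppr0 expR0 sin0 cos0 -EFinB; congr EFin.
  ring.
- by move=> *; exact: f0.
- by apply: continuous_subspaceT => x; exact: cf.
- pose C := e^-1 + (`|b| + e) / (e ^+ 2 + b ^+ 2).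
  apply/norm_cvg0P.
  apply: (@squeeze_cvgr _ _ _ _ (cst 0) (fun x => expR (- (e * x)) * C)).
  + apply: nearW => x; rewrite normr_ge0/= normrM ger0_norm ?expR_ge0//.
    rewrite ler_wpM2l ?expR_ge0// (le_trans (ler_normD _ _))//.
    rewrite normrN gtr0_norm ?invr_gt0// lerD2l normrM.
    rewrite [X in _ * X]gtr0_norm ?invr_gt0// ler_wpM2r ?invr_ge0 ?(ltW c0)//.
    rewrite (le_trans (ler_normB _ _))// !normrM (gtr0_norm e0) lerD//.
      by rewrite ler_piMr// sin_max.
    by rewrite ler_piMr ?cos_max// ltW.
  + exact: cvg_cst.
  + rewrite -[X in _ --> X](mul0r C); apply: cvgM; last exact: cvg_cst.
    apply: (@cvg_comp _ _ _ (fun x : R => e * x) (fun x => expR (- x)) _ +oo%R).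
      exact: gt0_cvgMry.
    exact: cvgr_expR.
- by move=> x _; exact: ex_derive.
- apply: cvg_at_right_filter.
  by apply: differentiable_continuous; apply/derivable1_diffP; exact: ex_derive.
- move=> x; rewrite in_itv/= andbT => x0.
  by rewrite derive1E derive_val /g /f gtr0_norm.
Qed.

Lemma integrable_laplace (e : R) : 0 < e ->
  mu.-integrable setT (EFin \o (fun x => expR (- (e * `|x|)))).
Proof.
move=> e0.
have := @integralT_laplace_1Dcos e 0 e0.
under eq_integral do rewrite mul0r cos0.
move=> E.
have mf : measurable_fun [set: R] (fun x : R => expR (- (e * `|x|))).
  apply: measurableT_comp => //; apply: measurableT_comp => //.
  apply: measurable_funM => //; exact: measurableT_comp.
apply: (@le_integrable _ _ _ mu setT _ _
  (EFin \o (fun x => expR (- (e * `|x|)) * (1 + 1)))) => //.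
- exact/measurable_EFinP.
- move=> x _; rewrite /= lee_fin normrM ler_peMr//.
  by rewrite ger0_norm ?addr_ge0// lerDl.
- apply/integrableP; split.
    by apply/measurable_EFinP; exact: measurable_funM.
  under eq_integral.
    move=> x _; rewrite gee0_abs; last by rewrite lee_fin mulr_ge0 ?expR_ge0.
    over.
  by rewrite /= E ltry.
Qed.

Lemma integrable_laplaceM (e : R) (h : R -> R) : 0 < e ->
  measurable_fun setT h -> (forall x, `|h x| <= 1) ->
  mu.-integrable setT (EFin \o (fun x => expR (- (e * `|x|)) * h x)).
Proof.
move=> e0 mh h1; have i0 := integrable_laplace e0.
apply: (le_integrable _ _ _ i0) => //.
  apply/measurable_EFinP/measurable_funM => //.
  by apply/measurable_EFinP; case/integrableP : i0.
move=> x _; rewrite /= lee_fin normrM [leRHS]ger0_norm ?expR_ge0//.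
by rewrite ger0_norm ?expR_ge0// ler_piMr ?expR_ge0.
Qed.

Lemma Rintegral_laplace_cos (e b : R) : 0 < e ->
  \int[mu]_x (expR (- (e * `|x|)) * cos (b * x)) = 2 * e / (e ^+ 2 + b ^+ 2).
Proof.
move=> e0.
have i0 := integrable_laplace e0.
have ic : mu.-integrable setT
    (EFin \o (fun x => expR (- (e * `|x|)) * cos (b * x))).
  apply: integrable_laplaceM => //; last by move=> x; exact: cos_max.
  apply: measurableT_comp; first exact: (continuous_measurable_fun (@continuous_cos R)).
  exact: measurable_funM.
have E0 : \int[mu]_x expR (- (e * `|x|)) = 2 * e^-1.
  have := congr1 fine (@integralT_laplace_1Dcos e 0 e0).
  rewrite -[LHS]/(\int[mu]_x (expR (- (e * `|x|)) * (1 + cos (0 * x)))).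
  under eq_Rintegral do rewrite mul0r cos0.
  rewrite RintegralZr//= => /(congr1 (fun z => z / 2)).
  rewrite mulfK// => ->; rewrite expr0n/= addr0.
  by field; rewrite gt_eqF.
have := congr1 fine (@integralT_laplace_1Dcos e b e0).
rewrite -[LHS]/(\int[mu]_x (expR (- (e * `|x|)) * (1 + cos (b * x)))).
under eq_Rintegral do rewrite mulrDr mulr1.
by rewrite RintegralD//= E0 mulrDr mulrA => /addrI.
Qed.

(** Lebesgue measure is invariant under reflection, so the integral equals its own opposite. *)
Lemma Rintegral_odd (f : R -> R) : mu.-integrable setT (EFin \o f) ->
  (forall x, f (- x) = - f x) -> \int[mu]_x f x = 0.
Proof.
move=> fi oddf; have /integrableP[mf _] := fi.
have : \int[mu]_x f x = - \int[mu]_x f x.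
  rewrite -mulN1r -RintegralZl// /Rintegral; congr fine.
  transitivity (\int[pushforward mu (-%R : _ -> measurableTypeR R)]_x (f x)%:E)%E.
    apply: eq_measure_integral => A mA _; exact/esym/lebesgue_measureN.
  have mN : measurable_fun [set: measurableTypeR R]
      (-%R : measurableTypeR R -> measurableTypeR R) by [].
  have fN : mu.-integrable [set: measurableTypeR R] (fun x => (f (- x))%:E).
    have /integrableN := fi.
    by apply: eq_integrable => // x _; rewrite /= oddf.
  have H := @integral_pushforward _ _ (measurableTypeR R) (measurableTypeR R) R
    -%R mN mu setT (EFin \o f) mf fN measurableT.
  rewrite [LHS]H.
  by apply: eq_integral => x _; rewrite /= oddf mulN1r.
by move=> /eqP; rewrite -addr_eq0 -mulr2n mulrn_eq0/= => /eqP.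
Qed.

Lemma Rintegral_laplace_sin (e b : R) : 0 < e ->
  \int[mu]_x (expR (- (e * `|x|)) * sin (b * x)) = 0.
Proof.
move=> e0; apply: Rintegral_odd; last first.
  by move=> x; rewrite normrN mulrN sinN mulrN.
apply: integrable_laplaceM => //; last by move=> x; exact: sin_max.
apply: measurableT_comp; first exact: (continuous_measurable_fun (@continuous_sin R)).
exact: measurable_funM.
Qed.

End one_dim.

(** * Integration over R^(d+1) by splitting off the first coordinate *)

Section lebesgue_rV_integration.
Context {R : realType}.
Local Notation mu := (@lebesgue_measure R).

Lemma cons_rV0 d (z : measurableTypeR R * 'rV[R]_d) : cons_rV z ord0 ord0 = z.1.
Proof.
rewrite /cons_rV (_ : ord0 = lshift d (ord0 : 'I_1)); last exact/val_inj.
by apply: (etrans (row_mxEl _ _ _ _)); rewrite [LHS]mxE eqxx mulr1n.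
Qed.

Lemma cons_rVS d (z : measurableTypeR R * 'rV[R]_d) (i : 'I_d) :
  cons_rV z ord0 (lift ord0 i) = z.2 ord0 i.
Proof.
rewrite /cons_rV (_ : lift ord0 i = rshift 1 i); last exact/val_inj.
exact: row_mxEr.
Qed.

Lemma dotp_cons_rV d (x : 'rV[R]_d.+1) (z : measurableTypeR R * 'rV[R]_d) :
  dotp (cons_rV z) x =
  x ord0 ord0 * z.1 + dotp z.2 (\row_i x ord0 (lift ord0 i)).
Proof.
rewrite /dotp big_ord_recl cons_rV0 mulrC; congr (_ + _).
by apply: eq_bigr => i _; rewrite cons_rVS mxE.
Qed.

Lemma ge0_integral_lebesgue_rVS d (f : 'rV[R]_d.+1 -> R) :
  measurable_fun setT f -> (forall v, 0 <= f v) ->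
  (\int[lebesgue_rV d.+1]_v (f v)%:E =
   \int[mu]_x \int[lebesgue_rV d]_v (f (cons_rV (x, v)))%:E)%E.
Proof.
move=> mf f0; have mc := @measurable_cons_rV R d.
rewrite [LHS](@ge0_integral_pushforward _ _ _ _ R _ mc _ setT (EFin \o f))//.
- rewrite preimage_setT fubini_tonelli1//.
  + by apply: measurableT_comp => //; exact/measurableT_comp.
  + by move=> z; rewrite /= lee_fin.
- exact/measurable_EFinP.
- by move=> v _; rewrite /= lee_fin.
Qed.

Lemma ge0_integral_prod_rV d (f : 'I_d -> R -> R) (I : 'I_d -> R) :
  (forall i, measurable_fun setT (f i)) -> (forall i u, 0 <= f i u) ->
  (forall i, (\int[mu]_u (f i u)%:E = (I i)%:E)%E) ->
  (\int[lebesgue_rV d]_v (\prod_i f i (v ord0 i))%:E = (\prod_i I i)%:E)%E.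
Proof.
elim: d f I => [|d IH] f I mf f0 fI.
  rewrite big_ord0; under eq_integral do rewrite big_ord0.
  by rewrite integral_dirac//= diracT mul1e.
rewrite ge0_integral_lebesgue_rVS; last 2 first.
- apply: measurable_prod => i _.
  by apply: (measurableT_comp (mf i)); exact: measurable_coord.
- by move=> v; apply: prodr_ge0.
under eq_integral => x _.
  under eq_integral => v _.
    rewrite big_ord_recl cons_rV0 /=.
    under eq_bigr do rewrite cons_rVS/=.
    rewrite EFinM.
    over.
  rewrite ge0_integralZl//; last 3 first.
  - apply/measurable_EFinP; apply: measurable_prod => i _.
    by apply: (measurableT_comp (mf _)); exact: measurable_coord.
  - by move=> v _; rewrite lee_fin prodr_ge0.
  - by rewrite lee_fin.
  rewrite (IH (fun i => f (lift ord0 i)) (fun i => I (lift ord0 i)))//.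
  over.
rewrite ge0_integralZr//=; last 3 first.
- by apply/measurable_EFinP; exact: mf.
- by move=> x _; rewrite lee_fin.
- rewrite lee_fin prodr_ge0// => i _.
  by rewrite -lee_fin -fI integral_ge0// => u _; rewrite lee_fin.
by rewrite fI -EFinM big_ord_recl.
Qed.

(** Fubini for signed functions. The inner integral is required to have a real value [g x] for every
    x, which allows passing from extended to real integrals. *)
Lemma Rintegral_lebesgue_rVS d (f : 'rV[R]_d.+1 -> R) (g : R -> R) :
  (lebesgue_rV d.+1).-integrable setT (EFin \o f) ->
  (forall x, (\int[lebesgue_rV d]_v (f (cons_rV (x, v)))%:E = (g x)%:E)%E) ->
  \int[lebesgue_rV d.+1]_v f v = \int[mu]_x g x.
Proof.
move=> fi fg; have /integrableP[mf foo] := fi.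
have mc := @measurable_cons_rV R d.
pose m : {sigma_finite_measure set _ -> \bar R} := lebesgue_rV d.
have ci : (lebesgue_measure \x m)%E.-integrable
    [set: measurableTypeR R * 'rV[R]_d] ((EFin \o f) \o @cons_rV R d).
  apply/integrableP; split; first exact: measurableT_comp.
  have := @ge0_integral_pushforward _ _ _ _ R _ mc (lebesgue_measure \x m)%E
    setT (abse \o (EFin \o f)) measurableT.
  rewrite preimage_setT => <-//; first exact: measurableT_comp.
  by move=> v _; exact: abse_ge0.
have := integral12_prod_meas1 ci.
have H := @integral_pushforward _ _ _ _ R _ mc (lebesgue_measure \x m)%E
    setT (EFin \o f) mf ci measurableT.
move=> H2; rewrite /Rintegral; congr fine.
rewrite [LHS]H preimage_setT -H2; apply: eq_integral => x _.
exact: fg.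
Qed.

End lebesgue_rV_integration.

(** * The exponential weight on R^d and its cosine transform *)

Section laplace_weight.
Context {R : realType}.
Local Notation mu := (@lebesgue_measure R).

(** The exponential of -e times the l^1 norm, kept as a product over coordinates so that integrals
    factor. *)
Definition laplace_rV d (e : R) (v : 'rV[R]_d) : R :=
  \prod_i expR (- (e * `|v ord0 i|)).

Lemma laplace_rV_ge0 d e (v : 'rV[R]_d) : 0 <= laplace_rV e v.
Proof. by apply: prodr_ge0 => i _; exact: expR_ge0. Qed.

Lemma laplace_rV_le1 d e (v : 'rV[R]_d) : 0 <= e -> laplace_rV e v <= 1.
Proof.
move=> e0; apply: prodr_ile1 => i _.
by rewrite expR_ge0 -expR0 ler_expR oppr_le0 mulr_ge0.
Qed.

Lemma measurable_laplace_rV d e : measurable_fun setT (@laplace_rV d e).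
Proof.
apply: measurable_prod => i _.
apply: measurableT_comp => //; apply: measurableT_comp => //.
apply: measurable_funM => //; apply: measurableT_comp => //.
exact: measurable_coord.
Qed.

Lemma measurable_dotp d' (T : measurableType d') d (f g : T -> 'rV[R]_d) :
  measurable_fun setT f -> measurable_fun setT g ->
  measurable_fun setT (fun t => dotp (f t) (g t)).
Proof.
move=> mf mg; apply: measurable_sum => i; apply: measurable_funM.
  exact: (measurableT_comp (measurable_coord i) mf).
exact: (measurableT_comp (measurable_coord i) mg).
Qed.

Lemma measurable_cosT d' (T : measurableType d') (f : T -> R) :
  measurable_fun setT f -> measurable_fun setT (fun t => cos (f t)).
Proof.
move=> mf; apply: (measurableT_comp _ mf).
exact: (continuous_measurable_fun (@continuous_cos R)).
Qed.

Lemma measurable_sinT d' (T : measurableType d') (f : T -> R) :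
  measurable_fun setT f -> measurable_fun setT (fun t => sin (f t)).
Proof.
move=> mf; apply: (measurableT_comp _ mf).
exact: (continuous_measurable_fun (@continuous_sin R)).
Qed.

Lemma integral_laplace (e : R) : 0 < e ->
  (\int[mu]_x (expR (- (e * `|x|)))%:E = (2 / e)%:E)%E.
Proof.
move=> e0; rewrite -[LHS]fineK; last first.
  by apply: integrable_fin_num => //; exact: integrable_laplace.
congr EFin; have := @Rintegral_laplace_cos R e 0 e0.
under eq_Rintegral do rewrite mul0r cos0 mulr1.
rewrite /Rintegral => ->; rewrite expr0n addr0/=.
by field; rewrite gt_eqF.
Qed.

Lemma integrable_laplace_rV d (e : R) : 0 < e ->
  (lebesgue_rV d).-integrable setT (EFin \o (@laplace_rV d e)).
Proof.
move=> e0; apply/integrableP; split.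
  by apply/measurable_EFinP; exact: measurable_laplace_rV.
under eq_integral do rewrite /= ger0_norm ?laplace_rV_ge0//.
rewrite (@ge0_integral_prod_rV _ d (fun _ u => expR (- (e * `|u|)))
  (fun _ => 2 / e)) ?ltry//.
  move=> _; apply: measurableT_comp => //; apply: measurableT_comp => //.
  by apply: measurable_funM => //; exact: measurableT_comp.
by move=> _; exact: integral_laplace.
Qed.

Lemma integrable_bounded_mul d' (T : measurableType d')
    (m : {measure set T -> \bar R}) (w h : T -> R) (B : R) :
  m.-integrable setT (EFin \o w) -> measurable_fun setT h ->
  (forall x, `|h x| <= B) ->
  m.-integrable setT (EFin \o (fun x => w x * h x)).
Proof.
move=> iw mh hB.
have := integrableMl measurableT iw mh.
move=> /(_ _); apply.
exists B; split; first exact: num_real.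
by move=> M BM x _; rewrite /= (le_trans (hB x))// ltW.
Qed.

(** Induction on the dimension: the addition formula for cos separates the first coordinate, and the
    product of sines contributes nothing because the one-dimensional sine transform of an even
    weight is 0. *)
Lemma Rintegral_laplace_rV_cos d (e : R) (x : 'rV[R]_d) : 0 < e ->
  \int[lebesgue_rV d]_v (laplace_rV e v * cos (dotp v x)) =
  \prod_i (2 * e / (e ^+ 2 + x ord0 i ^+ 2)).
Proof.
move=> e0; elim: d x => [|d IH] x.
  rewrite big_ord0 /Rintegral integral_dirac//=; last first.
    apply/measurable_EFinP; apply: measurable_funM.
      exact: measurable_laplace_rV.
    by apply: measurable_cosT; exact: measurable_dotp.
  rewrite indicT mul1r.
  by rewrite /laplace_rV /dotp !big_ord0 cos0 mulr1.
pose y := \row_i x ord0 (lift ord0 i).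
pose S := \int[lebesgue_rV d]_v (laplace_rV e v * sin (dotp v y)).
pose C := \int[lebesgue_rV d]_v (laplace_rV e v * cos (dotp v y)).
pose a := x ord0 ord0.
pose k (u : R) := expR (- (e * `|u|)).
have mdy n (z : 'rV[R]_n) : measurable_fun setT (fun v => dotp v z).
  exact: measurable_dotp.
have icos n (z : 'rV[R]_n) : (lebesgue_rV n).-integrable setT
    (EFin \o (fun v => laplace_rV e v * cos (dotp v z))).
  apply: (@integrable_bounded_mul _ _ _ _ _ 1).
  - exact: integrable_laplace_rV.
  - exact: measurable_cosT.
  - by move=> ?; exact: cos_max.
have isin n (z : 'rV[R]_n) : (lebesgue_rV n).-integrable setT
    (EFin \o (fun v => laplace_rV e v * sin (dotp v z))).
  apply: (@integrable_bounded_mul _ _ _ _ _ 1).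
  - exact: integrable_laplace_rV.
  - exact: measurable_sinT.
  - by move=> ?; exact: sin_max.
rewrite (@Rintegral_lebesgue_rVS _ d _
  (fun u => k u * cos (a * u) * C - k u * sin (a * u) * S)); last 2 first.
- exact: icos.
- move=> u.
  under eq_integral => v _.
    rewrite dotp_cons_rV -/a -/y/= cosD.
    rewrite /laplace_rV big_ord_recl cons_rV0/=.
    under eq_bigr do rewrite cons_rVS/=.
    rewrite -/(laplace_rV e v) -/(k u).
    rewrite (_ : _ * _ = k u * cos (a * u) * (laplace_rV e v * cos (dotp v y)) -
      k u * sin (a * u) * (laplace_rV e v * sin (dotp v y))); last by ring.
    rewrite EFinB.
    over.
  have iz (c : R) f : (lebesgue_rV d).-integrable setT (EFin \o f) ->
      (lebesgue_rV d).-integrable setT (fun v => (c * f v)%:E).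
    move=> fi; have := integrableZl measurableT c fi.
    by apply: eq_integrable.
  rewrite integralB_EFin//; [|exact: iz|exact: iz].
  have iE (c : R) f : (lebesgue_rV d).-integrable setT (EFin \o f) ->
      (\int[lebesgue_rV d]_v (c * f v)%:E =
       (c * \int[lebesgue_rV d]_v f v)%:E)%E.
    move=> fi; rewrite -RintegralZl// fineK//.
    by apply: integrable_fin_num => //; exact: iz.
  by rewrite !iE.
have i1 : mu.-integrable setT (EFin \o (fun u => k u * cos (a * u))).
  apply: integrable_laplaceM => //; last by move=> ?; exact: cos_max.
  by apply: measurable_cosT; exact: measurable_funM.
have i2 : mu.-integrable setT (EFin \o (fun u => k u * sin (a * u))).
  apply: integrable_laplaceM => //; last by move=> ?; exact: sin_max.
  by apply: measurable_sinT; exact: measurable_funM.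
rewrite RintegralB//; last 2 first.
- by have := integrableZr measurableT C i1; apply: eq_integrable.
- by have := integrableZr measurableT S i2; apply: eq_integrable.
rewrite !RintegralZr// Rintegral_laplace_sin// mul0r subr0.
rewrite Rintegral_laplace_cos// big_ord_recl; congr (_ * _).
by rewrite /C IH; apply: eq_bigr => i _; rewrite mxE.
Qed.

End laplace_weight.

(** * Positive definite multipliers *)

Lemma integrable_bounded d (T : measurableType d) (R : realType)
    (m : {measure set T -> \bar R}) (D : set T) (g : T -> R) (B : R) :
  measurable D -> (m D < +oo)%E -> measurable_fun D g ->
  (forall x, `|g x| <= B) -> m.-integrable D (EFin \o g).
Proof.
move=> mD mDoo mg gB; apply: measurable_bounded_integrable => //.
exists B; split; first exact: num_real.
by move=> M BM x _; rewrite /= (le_trans (gB x))// ltW.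
Qed.

(** * Fubini for a bounded kernel, an integrable weight and a finite measure *)

Section bounded_fubini.
Context {R : realType} d1 d2 (T1 : measurableType d1) (T2 : measurableType d2).
Variables (m1 : {sigma_finite_measure set T1 -> \bar R}).
Variables (m2 : {finite_measure set T2 -> \bar R}).
Variables (h : T1 * T2 -> R) (B : R).
Hypotheses (mh : measurable_fun setT h) (hB : forall z, `|h z| <= B).

Let integrable_h x : m2.-integrable setT (fun y => (h (x, y))%:E).
Proof.
apply: (@integrable_bounded _ _ _ _ _ (fun y => h (x, y)) B) => //.
- exact: fin_num_fun_lty.
- exact: measurableT_comp mh _.
Qed.

(** Adding the constant [B] makes the integrand nonnegative, so Tonelli gives measurability; the
    constant contributes a finite amount that is subtracted afterwards. *)
Lemma measurable_Rintegral_bounded :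
  measurable_fun setT (fun x => \int[m2]_y h (x, y)).
Proof.
have mhB : measurable_fun setT (fun z => (h z + B)%:E).
  by apply/measurable_EFinP; exact: measurable_funD.
have hB0 z : (0 <= (h z + B)%:E)%E.
  by rewrite lee_fin -lerBlDr sub0r; have := hB z; rewrite ler_norml => /andP[].
have := @measurable_fun_fubini_tonelli_F _ _ _ _ R m2 _ mhB hB0.
move=> /(measurableT_comp (@fine_measurable R setT measurableT)) mF.
rewrite (_ : (fun _ => _) =
    (fun x => fine (\int[m2]_y (h (x, y) + B)%:E) - B * fine (m2 setT))).
  exact: measurable_funB.
apply/funext => x; rewrite -[fine _]/(\int[m2]_y (h (x, y) + B)).
rewrite RintegralD//.
- by rewrite Rintegral_cst// addrK.
- exact: integrable_h.
- exact: finite_measure_integrable_cst.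
Qed.

Lemma norm_Rintegral_bounded x :
  `|\int[m2]_y h (x, y)| <= B * fine (m2 setT).
Proof.
rewrite (le_trans (le_normr_Rintegral _ _))//; first exact: integrable_h.
rewrite -Rintegral_cst//; apply: le_Rintegral => //.
- by apply: (@integrable_norm _ _ _ _ _ (fun y => h (x, y))); exact: integrable_h.
- exact: finite_measure_integrable_cst.
Qed.

Section weight.
Variable w : T1 -> R.
Hypothesis iw : m1.-integrable setT (EFin \o w).

Let F (z : T1 * T2) := (w z.1 * h z)%:E.

Let iF : (m1 \x m2)%E.-integrable setT F.
Proof.
have /integrableP[mw wfin] := iw.
have mw' : measurable_fun setT w by exact/measurable_EFinP.
have mF : measurable_fun setT F.
  apply/measurable_EFinP; apply: measurable_funM => //.
  exact: (measurableT_comp mw').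
apply/integrable12ltyP => //.
have : (\int[m1]_x ((B * fine (m2 setT))%:E * `|(w x)%:E|) < +oo)%E.
  rewrite ge0_integralZl//.
  (* That [B] is nonnegative is read off [hB] at an arbitrary point. *)
  - by rewrite lte_mul_pinfty// lee_fin mulr_ge0// ?fine_ge0// (le_trans _ (hB point)).
  - exact: measurableT_comp.
  - by rewrite lee_fin mulr_ge0// ?fine_ge0// (le_trans _ (hB point)).
apply: le_lt_trans; apply: ge0_le_integral => //.
- by move=> x _; apply: integral_ge0.
- apply: (measurable_fun_fubini_tonelli_F (abse \o F)).
    exact: measurableT_comp.
  by move=> z; exact: abse_ge0.
- by apply: emeasurable_funM => //; exact: measurableT_comp.
- move=> x _; apply: le_trans.
    apply: (@integral_le_bound _ _ _ m2 setT (fun y => F (x, y))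
      (`|w x| * B)%:E) => //.
    + exact: (measurableT_comp mF).
    + by rewrite lee_fin mulr_ge0// (le_trans _ (hB point)).
    + by apply: aeW => y _; rewrite /= lee_fin normrM ler_wpM2l.
  rewrite -[X in (_ * X)%E]fineK ?fin_num_measure// -EFinM.
  by rewrite lee_fin -mulrA mulrC.
Qed.

Let GE y : (\int[m1]_x (w x * h (x, y))%:E = (\int[m1]_x (w x * h (x, y)))%:E)%E.
Proof.
rewrite fineK//; apply: integrable_fin_num => //.
apply: (integrable_bounded_mul iw) => //.
exact: measurableT_comp mh _.
Qed.

Lemma Rintegral_fubini_bounded :
  \int[m1]_x (w x * \int[m2]_y h (x, y)) =
  \int[m2]_y \int[m1]_x (w x * h (x, y)).
Proof.
have := Fubini iF; rewrite /F/= => E.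
rewrite /Rintegral; congr fine.
transitivity (\int[m1]_x \int[m2]_y (w x * h (x, y))%:E)%E.
  apply: eq_integral => x _.
  rewrite -[fine _]/(\int[m2]_y h (x, y)) -RintegralZl//; last exact: integrable_h.
  rewrite /Rintegral fineK//.
  apply: integrable_fin_num => //.
  by have := integrableZl measurableT (w x) (integrable_h x); apply: eq_integrable.
by rewrite E; apply: eq_integral => y _; rewrite GE.
Qed.

(** The inner integral is bounded by [B] times the integral of |w|, and [m2] is finite. *)
Lemma integrable_fubini_bounded :
  m2.-integrable setT (EFin \o (fun y => \int[m1]_x (w x * h (x, y)))).
Proof.
have mG := measurable_fubini_G iF.
pose g y := \int[m1]_x (w x * h (x, y)).
apply: (@integrable_bounded _ _ _ m2 _ g (\int[m1]_x `|w x| * B)) => //.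
- exact: fin_num_fun_lty.
- apply/measurable_EFinP; apply: (eq_measurable_fun _ _ mG) => y _.
  exact: GE.
- move=> y; rewrite /g.
  have iy : m1.-integrable setT (EFin \o (fun x => w x * h (x, y))).
    apply: (integrable_bounded_mul iw) => //.
    exact: measurableT_comp mh _.
  rewrite (le_trans (le_normr_Rintegral _ _))//.
  rewrite -RintegralZr//; last exact: integrable_norm.
  apply: le_Rintegral => //.
  + exact: (integrable_norm iy).
  + by have := integrableZr measurableT B (integrable_norm iw); apply: eq_integrable.
  + by move=> x _; rewrite normrM ler_wpM2l.
Qed.

End weight.

End bounded_fubini.

(** * Weighted cosine transforms and the closure properties of positive definite multipliers *)

Section positive_definite_multipliers.
Context {R : realType} {d : nat}.
Local Notation V := 'rV[R]_d.

Lemma dotpDr (x y z : V) : dotp x (y + z) = dotp x y + dotp x z.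
Proof.
by rewrite /dotp -big_split; apply: eq_bigr => i _; rewrite mxE mulrDr.
Qed.

Lemma dotpNr (x y : V) : dotp x (- y) = - dotp x y.
Proof.
by rewrite /dotp -sumrN; apply: eq_bigr => i _; rewrite mxE mulrN.
Qed.

Lemma dotp0r (x : V) : dotp x 0 = 0.
Proof. by rewrite /dotp big1// => i _; rewrite mxE mulr0. Qed.

(** Real part of the Fourier transform of [mu]. *)
Definition cosft (mu : {measure set V -> \bar R}) (v : V) : R :=
  \int[mu]_y cos (dotp v y).

Lemma measurable_cos_dotp :
  measurable_fun setT (fun z : V * V => cos (dotp z.1 z.2)).
Proof.
by apply: measurable_cosT; apply: measurable_dotp.
Qed.

Lemma measurable_cosft (mu : {finite_measure set V -> \bar R}) :
  measurable_fun setT (cosft mu).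
Proof.
apply: (@measurable_Rintegral_bounded _ _ _ _ _ mu
  (fun z : V * V => cos (dotp z.1 z.2)) 1).
  exact: measurable_cos_dotp.
by move=> z; exact: cos_max.
Qed.

Lemma norm_cosft (mu : {finite_measure set V -> \bar R}) v :
  `|cosft mu v| <= fine (mu setT).
Proof.
rewrite -[leRHS]mul1r.
apply: (@norm_Rintegral_bounded _ _ _ _ _ mu
  (fun z : V * V => cos (dotp z.1 z.2)) 1).
  exact: measurable_cos_dotp.
by move=> z; exact: cos_max.
Qed.

Variables (m : {sigma_finite_measure set V -> \bar R}) (w : V -> R).
Hypothesis iw : m.-integrable setT (EFin \o w).

(** The integrable weight [w] makes the transform of any bounded measurable multiplier converge
    absolutely, with no decay asked of [g]. *)
Definition wft (g : V -> R) (x : V) : R :=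
  \int[m]_v (w v * (g v * cos (dotp v x))).

Definition posdef (g : V -> R) := [/\ measurable_fun setT g,
  exists B : R, forall v, `|g v| <= B & forall x, 0 <= wft g x].

Lemma integrable_wft (g : V -> R) (B : R) (x : V) : measurable_fun setT g ->
  (forall v, `|g v| <= B) ->
  m.-integrable setT (EFin \o (fun v => w v * (g v * cos (dotp v x)))).
Proof.
move=> mg gB; apply: (@integrable_bounded_mul _ _ _ _ _ _ B) => //.
  apply: measurable_funM => //; apply: measurable_cosT.
  exact: measurable_dotp.
move=> v; rewrite normrM (le_trans _ (gB v))// ler_piMr//.
exact: cos_max.
Qed.

(** Multiplication by [cosft mu] becomes convolution with the symmetrization of [mu]: expand the
    product of cosines cos(v.x) cos(v.y) as half the sum of cos(v.(x+y)) and cos(v.(x-y)), then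
    exchange the integrals. *)
Lemma wftM_cosft (mu : {finite_measure set V -> \bar R}) (g : V -> R) (B : R)
    (x : V) :
  measurable_fun setT g -> (forall v, `|g v| <= B) ->
  mu.-integrable setT
    (EFin \o (fun y => (wft g (x + y) + wft g (x - y)) / 2)) /\
  wft (fun v => g v * cosft mu v) x =
    \int[mu]_y ((wft g (x + y) + wft g (x - y)) / 2).
Proof.
move=> mg gB.
pose h (z : V * V) := g z.1 * cos (dotp z.1 x) * cos (dotp z.1 z.2).
have mgc : measurable_fun setT (fun v => g v * cos (dotp v x)).
  apply: measurable_funM => //; apply: measurable_cosT.
  exact: measurable_dotp.
have mh : measurable_fun setT h.
  apply: measurable_funM; last exact: measurable_cos_dotp.
  exact: (measurableT_comp mgc).
have hB z : `|h z| <= B.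
  rewrite /h !normrM (le_trans _ (gB z.1))//.
  rewrite -mulrA ler_piMr// mulr_ile1//; exact: cos_max.
have hE y : \int[m]_v (w v * h (v, y)) = (wft g (x + y) + wft g (x - y)) / 2.
  rewrite /wft -RintegralD//; [|exact: integrable_wft gB|exact: integrable_wft gB].
  rewrite -RintegralZr//; last first.
    have := integrableD measurableT (integrable_wft (x + y) mg gB)
      (integrable_wft (x - y) mg gB).
    by apply: eq_integrable => // v _; rewrite /= EFinD.
  apply: eq_Rintegral => v _; rewrite /h/= !dotpDr dotpNr cosD cosB.
  by field.
have -> : (fun y => (wft g (x + y) + wft g (x - y)) / 2) =
    (fun y => \int[m]_v (w v * h (v, y))).
  by apply/funext => y; rewrite hE.
split; first exact: (integrable_fubini_bounded mu mh hB iw).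
rewrite -(Rintegral_fubini_bounded mu mh hB iw).
apply: eq_Rintegral => v _; congr (_ * _).
rewrite mulrAC /h/= -RintegralZl//.
apply: (@integrable_bounded _ _ _ mu _ (fun y => cos (dotp v y)) 1) => //.
- exact: fin_num_fun_lty.
- by apply: measurable_cosT; exact: measurable_dotp.
- by move=> y; exact: cos_max.
Qed.

Lemma posdefM_cosft (mu : {finite_measure set V -> \bar R}) g :
  posdef g -> posdef (fun v => g v * cosft mu v).
Proof.
move=> [mg [B gB] g0]; split.
- by apply: measurable_funM => //; exact: measurable_cosft.
- exists (B * fine (mu setT)) => v; rewrite normrM.
  by rewrite ler_pM// norm_cosft.
- move=> x; rewrite (wftM_cosft mu x mg gB).2.
  by apply: Rintegral_ge0 => y _; rewrite divr_ge0// addr_ge0.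
Qed.

Lemma wftD (g1 g2 : V -> R) (B1 B2 : R) (x : V) :
  measurable_fun setT g1 -> measurable_fun setT g2 ->
  (forall v, `|g1 v| <= B1) -> (forall v, `|g2 v| <= B2) ->
  wft (fun v => g1 v + g2 v) x = wft g1 x + wft g2 x.
Proof.
move=> m1 m2 b1 b2; rewrite /wft -RintegralD//; last 2 first.
- exact: integrable_wft b1.
- exact: integrable_wft b2.
by apply: eq_Rintegral => v _; rewrite mulrDl mulrDr.
Qed.

Lemma wftZ (g : V -> R) (B c : R) (x : V) :
  measurable_fun setT g -> (forall v, `|g v| <= B) ->
  wft (fun v => c * g v) x = c * wft g x.
Proof.
move=> mg gB; rewrite /wft -RintegralZl//; last exact: integrable_wft gB.
by apply: eq_Rintegral => v _; ring.
Qed.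

Lemma posdefD g1 g2 : posdef g1 -> posdef g2 -> posdef (fun v => g1 v + g2 v).
Proof.
move=> [m1 [B1 b1] p1] [m2 [B2 b2] p2]; split.
- exact: measurable_funD.
- exists (B1 + B2) => v; rewrite (le_trans (ler_normD _ _))// lerD//.
- by move=> x; rewrite (wftD x m1 m2 b1 b2) addr_ge0.
Qed.

Lemma posdefZ g c : 0 <= c -> posdef g -> posdef (fun v => c * g v).
Proof.
move=> c0 [mg [B gB] pg]; split.
- exact: measurable_funM.
- by exists (c * B) => v; rewrite normrM ger0_norm// ler_wpM2l.
- by move=> x; rewrite (wftZ c x mg gB) mulr_ge0.
Qed.

Lemma posdef_sum n (g : nat -> V -> R) : (forall i, posdef (g i)) ->
  posdef (fun v => \sum_(i < n) g i v).
Proof.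
move=> pg; elim: n => [|n IH].
  under eq_fun do rewrite big_ord0.
  by have := posdefZ (lexx 0) (pg 0%N); under eq_fun do rewrite mul0r.
under eq_fun do rewrite big_ord_recr/=.
exact: posdefD.
Qed.

(** Dominated convergence with majorant |w| B. *)
Lemma cvg_wft (g_ : nat -> V -> R) (g : V -> R) (B : R) (x : V) :
  (forall n, measurable_fun setT (g_ n)) -> (forall n v, `|g_ n v| <= B) ->
  (forall v, g_ n v @[n --> \oo] --> g v) ->
  [/\ measurable_fun setT g, forall v, `|g v| <= B &
      wft (g_ n) x @[n --> \oo] --> wft g x].
Proof.
move=> mg_ gB g_g.
have mg : measurable_fun setT g.
  by apply: (measurable_fun_cvg mg_) => v _; exact: g_g.
have gB' v : `|g v| <= B.
  apply: (cvgr_to_le (cvg_norm (g_g v))); apply: nearW => n; exact: gB.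
split => //.
have mfn n := measurable_int _ (integrable_wft x (mg_ n) (gB n)).
have [|||_ _ +] := @dominated_convergence _ _ R m setT measurableT
  (fun n v => (w v * (g_ n v * cos (dotp v x)))%:E)
  (fun v => (w v * (g v * cos (dotp v x)))%:E)
  (fun v => (`|w v| * B)%:E) mfn (measurable_int _ (integrable_wft x mg gB')).
- apply: aeW => v _; apply: cvg_EFin; first exact: nearW.
  apply: cvgM; first exact: cvg_cst.
  apply: cvgM; [exact: g_g|exact: cvg_cst].
- by have := integrableZr measurableT B (integrable_norm iw); apply: eq_integrable.
- apply: aeW => v n _; rewrite /= lee_fin normrM ler_wpM2l//.
  by rewrite normrM (le_trans _ (gB n v))// ler_piMr// cos_max.
- move=> H; apply: fine_cvg; rewrite fineK.
    exact: H.
  by apply: integrable_fin_num => //; exact: (integrable_wft x mg gB').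
Qed.

Lemma posdef_lim (g_ : nat -> V -> R) (g : V -> R) (B : R) :
  (forall n, posdef (g_ n)) -> (forall n v, `|g_ n v| <= B) ->
  (forall v, g_ n v @[n --> \oo] --> g v) -> posdef g.
Proof.
move=> pg gB g_g.
have mg_ n : measurable_fun setT (g_ n) by have [] := pg n.
have [mg gB' _] := cvg_wft 0 mg_ gB g_g.
split => //; first by exists B.
move=> x; have [_ _ c] := cvg_wft x mg_ gB g_g.
apply: (cvgr_to_ge c); apply: nearW => n.
by have [_ _] := pg n; exact.
Qed.

Lemma sum_nat_shift (f : nat -> R) n k :
  \sum_(k <= i < n + k) f i = \sum_(i < n) f (i + k)%N.
Proof.
by rewrite -[X in \sum_(X <= _ < _) _]add0n big_addn addnK big_mkord.
Qed.

(** Each power of [cosft mu] preserves positive definiteness and the exponential series has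
    nonnegative coefficients, so a tail of it is a bounded limit of positive definite sums. The tail
    from k = 0 gives the full exponential; the one from k = 2 isolates the first order term. *)
Lemma posdef_exp_tail (mu : {finite_measure set V -> \bar R}) g (t : R) k :
  0 <= t -> posdef g ->
  posdef (fun v => g v *
    (expR (t * cosft mu v) - \sum_(i < k) exp_coeff (t * cosft mu v) i)).
Proof.
move=> t0 pg; have [mg [B gB] _] := pg.
pose u v := t * cosft mu v.
pose U := t * fine (mu setT).
have uU v : `|u v| <= U by rewrite normrM ger0_norm// ler_wpM2l// norm_cosft.
have U0 : 0 <= U := le_trans (normr_ge0 _) (uU 0).
have pi i : posdef (fun v => g v * exp_coeff (u v) i).
  rewrite /exp_coeff/=.
  have -> : (fun v => g v * (u v ^+ i / i`!%:R)) =
      (fun v => (t ^+ i / i`!%:R) * (g v * cosft mu v ^+ i)).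
    by apply/funext => v; rewrite /u exprMn; ring.
  apply: posdefZ; first by rewrite divr_ge0// exprn_ge0.
  elim: i => [|i IH]; first by under eq_fun do rewrite expr0 mulr1.
  under eq_fun do rewrite exprSr mulrA.
  exact: posdefM_cosft.
have coef_le v i : `|exp_coeff (u v) i| <= exp_coeff U i.
  rewrite /exp_coeff/= normrM normfV [X in _ / X]ger0_norm// ler_wpM2r// ?invr_ge0//.
  by rewrite normrX lerXn2r ?nnegrE.
apply: (@posdef_lim (fun n v => \sum_(i < n) (g v * exp_coeff (u v) (i + k)%N)) _
  (B * expR U)).
- by move=> n; apply: (@posdef_sum n (fun i v => g v * exp_coeff (u v) (i + k)%N)).
- move=> n v; rewrite -mulr_sumr normrM ler_pM//.
  rewrite (le_trans (ler_norm_sum _ _ _))//.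
  apply: (@le_trans _ _ (\sum_(i < n) exp_coeff U (i + k)%N)).
    by apply: ler_sum.
  (* Restoring the first [k] nonnegative terms turns the shifted sum into a partial sum of the
     series at [U], which increases to exp(U); this bound is uniform in [n] and [v]. *)
  have : series (exp_coeff U) (n + k)%N <= expR U.
    apply: nondecreasing_cvgn_le; last exact: is_cvg_series_exp_coeff.
    apply: nondecreasing_series => i _ _.
    by rewrite /exp_coeff/= divr_ge0// exprn_ge0.
  apply: le_trans; rewrite /series/= (@big_cat_nat _ _ _ k)//= ?leq_addl//.
  rewrite -[leLHS]add0r lerD//.
    by apply: sumr_ge0 => i _; rewrite /exp_coeff/= divr_ge0// exprn_ge0.
  by rewrite sum_nat_shift.
- move=> v; under eq_fun do rewrite -mulr_sumr.
  apply: cvgM; first exact: cvg_cst.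
  have -> : (fun n => \sum_(i < n) exp_coeff (u v) (i + k)%N) =
      (fun n => series (exp_coeff (u v)) (n + k)%N -
        \sum_(i < k) exp_coeff (u v) i).
    apply/funext => n.
    rewrite /series/= (@big_cat_nat _ _ _ k)//= ?leq_addl//.
    by rewrite big_mkord sum_nat_shift addrAC subrr add0r.
  apply: cvgB; last exact: cvg_cst.
  rewrite -/(u v) /expR.
  by rewrite (cvg_shiftn k (series (exp_coeff (u v)))); exact: is_cvg_series_exp_coeff.
Qed.

Lemma posdef_expM (mu : {finite_measure set V -> \bar R}) g (t : R) :
  0 <= t -> posdef g -> posdef (fun v => g v * expR (t * cosft mu v)).
Proof.
move=> t0 pg; have := posdef_exp_tail mu 0 t0 pg.
by under eq_fun do rewrite big_ord0 subr0.
Qed.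

(** With s = t [cosft mu], the difference exp(s) - s is 1 plus the tail of the series from order 2,
    and [g] times either of them is positive definite. *)
Lemma wft_expM_ge (mu : {finite_measure set V -> \bar R}) g (t : R) x :
  0 <= t -> posdef g ->
  t * wft (fun v => g v * cosft mu v) x <=
  wft (fun v => g v * expR (t * cosft mu v)) x.
Proof.
move=> t0 pg; have [mg [B gB] pg0] := pg.
have p2 := posdef_exp_tail mu 2 t0 pg.
have p1 := posdefM_cosft mu pg.
have [m2 [B2 b2] w2] := p2; have [m1 [B1 b1] w1] := p1.
have p1' := posdefZ t0 p1; have [m1' [B1' b1'] _] := p1'.
have [m3 [B3 b3] w3] := posdefD pg p2.
have -> : (fun v => g v * expR (t * cosft mu v)) =
  (fun v => t * (g v * cosft mu v) + (g v + g v *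
   (expR (t * cosft mu v) - \sum_(i < 2) exp_coeff (t * cosft mu v) i))).
  apply/funext => v.
  rewrite (_ : \sum_(i < 2) _ = 1 + t * cosft mu v); first by ring.
  by rewrite 2!big_ord_recl big_ord0 /exp_coeff/= expr0 expr1 !divr1 addr0.
rewrite (wftD x m1' m3 b1' b3) (wftZ t x m1 b1) lerDl.
exact: w3.
Qed.

End positive_definite_multipliers.

(** * Levy exponents *)

Section trigonometric_bounds.
Context {R : realType}.

Lemma norm_sin_le (x : R) : `|sin x| <= `|x|.
Proof.
wlog x0 : x / 0 < x.
  move=> H; have [x0|x0|->] := ltgtP x 0; last by rewrite sin0.
  - by rewrite -normrN -sinN -[leRHS]normrN H// oppr_gt0.
  - exact: H.
have [c _] := @MVT R sin cos 0 x x0 (fun y _ => is_derive_sin y)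
  (continuous_subspaceT (@continuous_sin R)).
rewrite sin0 !subr0 => ->.
by rewrite normrM ler_piMl// cos_max.
Qed.

(** The half-angle formula 1 - cos x = 2 sin(x/2)^2 reduces this to |sin y| <= |y|. *)
Lemma oneBcos_le (x : R) : 1 - cos x <= x ^+ 2 / 2.
Proof.
have -> : cos x = 1 - sin (x / 2) ^+ 2 *+ 2.
  rewrite {1}(_ : x = (x / 2) *+ 2) ?cos_mulr2n ?cos2sin2.
    by rewrite mulrnBl; ring.
  by rewrite -mulr_natr divfK.
rewrite opprB addrC subrK -mulr_natr.
have : sin (x / 2) ^+ 2 <= (x / 2) ^+ 2.
  rewrite -real_normK ?num_real// -[leRHS]real_normK ?num_real//.
  by rewrite lerXn2r ?nnegrE// norm_sin_le.
lra.
Qed.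

Lemma oneBcos_ge0 (x : R) : 0 <= 1 - cos x.
Proof. by rewrite subr_ge0 cos_le1. Qed.

Lemma oneBcos_le2 (x : R) : 1 - cos x <= 2.
Proof. by have := cos_geN1 x; lra. Qed.

End trigonometric_bounds.

(** * The Euclidean norm: Cauchy-Schwarz, triangle inequality, measurability *)

Section euclidean_norm.
Context {R : realType} {d : nat}.
Implicit Types x y z : 'rV[R]_d.

Lemma dotpC x y : dotp x y = dotp y x.
Proof. by apply: eq_bigr => i _; rewrite mulrC. Qed.

Lemma dotpZr a x y : dotp x (a *: y) = a * dotp x y.
Proof.
by rewrite /dotp mulr_sumr; apply: eq_bigr => i _; rewrite mxE mulrCA.
Qed.

Lemma dotpxx_ge0 x : 0 <= dotp x x.
Proof. by apply: sumr_ge0 => i _; rewrite -expr2 sqr_ge0. Qed.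

Lemma enorm_ge0 x : 0 <= enorm x.
Proof. exact: sqrtr_ge0. Qed.

Lemma sqr_enorm x : enorm x ^+ 2 = dotp x x.
Proof. by rewrite sqr_sqrtr// dotpxx_ge0. Qed.

Lemma enorm_eq0 x : enorm x = 0 -> x = 0.
Proof.
move=> /eqP; rewrite -sqrf_eq0 sqr_enorm psumr_eq0; last first.
  by move=> i _; rewrite -expr2 sqr_ge0.
move=> /allP h; apply/rowP => i; rewrite mxE.
by have := h i (mem_index_enum i); rewrite -expr2 sqrf_eq0 => /eqP.
Qed.

Lemma enormN x : enorm (- x) = enorm x.
Proof. by rewrite /enorm dotpNr dotpC dotpNr opprK. Qed.

(** Cauchy-Schwarz, from the nonnegative square of (y.y) x - (x.y) y. *)
Lemma dotp_sqr_le x y : dotp x y ^+ 2 <= dotp x x * dotp y y.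
Proof.
have [y0|y0] := eqVneq (dotp y y) 0.
  have -> : y = 0 by apply: enorm_eq0; rewrite /enorm y0 sqrtr0.
  by rewrite !dotp0r mulr0 expr0n.
have yp : 0 < dotp y y by rewrite lt_neqAle eq_sym y0 dotpxx_ge0.
have := dotpxx_ge0 (dotp y y *: x + (- dotp x y *: y)).
rewrite !(dotpDr, dotpZr) ![dotp (_ + _) _]dotpC !(dotpDr, dotpZr) [dotp y x]dotpC.
rewrite (_ : _ + _ = dotp y y * (dotp x x * dotp y y - dotp x y ^+ 2)); last by ring.
by rewrite pmulr_rge0// subr_ge0.
Qed.

Lemma norm_dotp_le x y : `|dotp x y| <= enorm x * enorm y.
Proof.
rewrite -(@ler_pXn2r _ 2)// ?nnegrE ?mulr_ge0 ?enorm_ge0//.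
by rewrite real_normK ?num_real// exprMn !sqr_enorm dotp_sqr_le.
Qed.

Lemma enormD_le x y : enorm (x + y) <= enorm x + enorm y.
Proof.
rewrite -(@ler_pXn2r _ 2)// ?nnegrE ?addr_ge0 ?enorm_ge0//.
rewrite sqr_enorm sqrrD !sqr_enorm dotpDr ![dotp (_ + _) _]dotpC !dotpDr.
have := norm_dotp_le x y; rewrite ler_norml => /andP[_].
rewrite [dotp y x]dotpC => h.
by rewrite -mulr_natr; lra.
Qed.

Lemma norm_coord_le x i : `|x ord0 i| <= enorm x.
Proof.
rewrite -(@ler_pXn2r _ 2)// ?nnegrE ?enorm_ge0// real_normK ?num_real//.
rewrite sqr_enorm /dotp (bigD1 i)//= -expr2 lerDl.
by apply: sumr_ge0 => j _; rewrite -expr2 sqr_ge0.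
Qed.

Lemma measurable_enorm : measurable_fun setT (@enorm R d).
Proof.
apply: (@measurableT_comp _ _ _ _ _ _ (@Num.sqrt R)).
  exact: (continuous_measurable_fun (@sqrt_continuous R)).
exact: measurable_dotp.
Qed.

Lemma measurable_eball x (r : R) : measurable (eball x r).
Proof.
have mf : measurable_fun setT (fun y => enorm (y - x)).
  apply: (measurableT_comp measurable_enorm).
  apply: measurable_fun_rV => i; under eq_fun do rewrite !mxE.
  by apply: measurable_funB => //; exact: measurable_coord.
have := measurable_fun_ltr mf (@measurable_cst _ _ _ _ setT r).
move=> /(_ measurableT [set true]); rewrite setTI; apply.
by [].
Qed.

End euclidean_norm.

Section restricted_measure.
Context d (T : measurableType d) (R : realType).
Variables (mu : {measure set T -> \bar R}) (D : set T).
Hypotheses (mD : measurable D) (muD : (mu D < +oo)%E).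

(** The restricted measure charges only [D]. It packages a piece of a Levy measure as a finite
    measure, to which the results on [cosft] apply. *)
Lemma integral_mfrestr (f : T -> \bar R) :
  (mfrestr mD muD).-integrable setT f ->
  (\int[mfrestr mD muD]_x f x = \int[mu]_(x in D) f x)%E.
Proof.
move=> fi; rewrite (@negligible_integral _ _ _ _ setT (~` D))//.
- rewrite setTD setCK; apply: eq_measure_integral => A mA AD.
  by rewrite /= /mfrestr /mrestr setIidl.
- exact: measurableC.
- by rewrite /= /mfrestr /mrestr setICl measure0.
Qed.

End restricted_measure.

(** * The part of the exponent carried by the jumps in a given set *)

Section levy_exponent_theory.
Context {R : realType} {d : nat}.
Local Notation V := 'rV[R]_d.
Variable nu : {measure set V -> \bar R}.
Hypothesis hnu : levy_measure nu.

Definition levy_part (D : set V) (v : V) : R :=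
  \int[nu]_(y in D) (1 - cos (dotp v y)).

Lemma measurable_min_sqr (c r : R) :
  measurable_fun setT (fun y : V => Num.min c (enorm y ^+ 2 / r ^+ 2)).
Proof.
apply: measurable_minr => //; apply: measurable_funM => //.
by apply: measurable_funX; exact: measurable_enorm.
Qed.

Lemma min_sqr_ge0 (c r : R) (y : V) : 0 <= c ->
  0 <= Num.min c (enorm y ^+ 2 / r ^+ 2).
Proof. by move=> c0; rewrite le_min c0 divr_ge0// sqr_ge0. Qed.

Lemma integrable_min_sqr (r : R) : 0 < r ->
  nu.-integrable setT (EFin \o (fun y : V => Num.min 1 (enorm y ^+ 2 / r ^+ 2))).
Proof.
move=> r0; have [_ nufin] := hnu.
have i1 : nu.-integrable setT (EFin \o (fun y : V => Num.min 1 (enorm y ^+ 2))).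
  apply/integrableP; split.
    apply/measurable_EFinP; have := measurable_min_sqr 1 1.
    by under eq_fun do rewrite expr1n divr1.
  under eq_integral do rewrite /= ger0_norm ?le_min ?ler01 ?sqr_ge0//.
  exact: nufin.
have i2 := integrableZl measurableT (1 + r ^- 2) i1.
apply: (le_integrable measurableT _ _ i2).
  by apply/measurable_EFinP; exact: measurable_min_sqr.
move=> y _; rewrite /= lee_fin ger0_norm ?min_sqr_ge0// ger0_norm; last first.
  by rewrite mulr_ge0 ?addr_ge0 ?invr_ge0 ?sqr_ge0// le_min ler01 sqr_ge0.
have r2 : 0 < r ^- 2 by rewrite invr_gt0 exprn_gt0.
set u := enorm y ^+ 2; have u0 : 0 <= u by rewrite sqr_ge0.
rewrite ge_min; have [u1|u1] := leP 1 u.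
  by rewrite mulr1 lerDl ltW.
by rewrite [u / _]mulrC ler_wpM2r ?orbT// lerDr.
Qed.

(** The integrand is at most (2 + |v|^2) min(1, |y|^2): use the bound 2 when |y| >= 1 and the
    quadratic bound with Cauchy-Schwarz otherwise. *)
Lemma integrable_oneBcos (D : set V) (v : V) : measurable D ->
  nu.-integrable D (EFin \o (fun y => 1 - cos (dotp v y))).
Proof.
move=> mD; apply: (integrableS measurableT) => //.
have := integrableZl measurableT (2 + enorm v ^+ 2) (integrable_min_sqr ltr01).
apply: le_integrable => //.
  apply/measurable_EFinP; apply: measurable_funB => //.
  by apply: measurable_cosT; exact: measurable_dotp.
move=> y _; rewrite /= lee_fin ger0_norm ?oneBcos_ge0//.
rewrite expr1n divr1 ger0_norm; last first.
  by rewrite mulr_ge0 ?addr_ge0 ?sqr_ge0// le_min ler01 sqr_ge0.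
have [u1|u1] := leP 1 (enorm y ^+ 2).
  by rewrite mulr1 (le_trans (oneBcos_le2 _))// lerDl sqr_ge0.
rewrite (le_trans (oneBcos_le _))//.
have h1 : dotp v y ^+ 2 <= enorm v ^+ 2 * enorm y ^+ 2.
  by rewrite !sqr_enorm dotp_sqr_le.
have h2 := sqr_ge0 (enorm y); have h3 := sqr_ge0 (enorm v).
have h4 : 0 <= enorm v ^+ 2 * enorm y ^+ 2 by rewrite mulr_ge0.
rewrite mulrDl; lra.
Qed.

(** Markov's inequality: min(1, |y|^2/r^2) is integrable and equals 1 off the ball. *)
Lemma levy_tail_lty (r : R) : 0 < r -> (nu (~` eball 0 r) < +oo)%E.
Proof.
move=> r0; have mD : measurable (~` eball (0 : V) r).
  by apply: measurableC; exact: measurable_eball.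
have /integrableP[mf foo] := integrable_min_sqr r0.
apply: le_lt_trans foo.
rewrite -[X in (X <= _)%E]mul1e -integral_cst// integral_mkcond.
apply: ge0_le_integral => //.
- by move=> y _; rewrite /patch; case: ifP.
- apply/measurable_restrict => //; exact: measurable_cst.
- exact: measurableT_comp.
- move=> y _; rewrite /patch; case: ifPn => [|_]; last exact: abse_ge0.
  rewrite inE /eball/= subr0 => /negP; rewrite -leNgt => ry.
  rewrite lee_fin ger0_norm ?min_sqr_ge0// le_min lexx/=.
  by rewrite ler_pdivlMr ?exprn_gt0// mul1r lerXn2r ?nnegrE ?enorm_ge0// ltW.
Qed.

Lemma levy_part_ge0 D v : 0 <= levy_part D v.
Proof. by apply: Rintegral_ge0 => y _; exact: oneBcos_ge0. Qed.

Lemma levy_exponentE D v : measurable D ->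
  levy_exponent nu v = levy_part D v + levy_part (~` D) v.
Proof.
move=> mD; rewrite /levy_exponent -(setUv D) Rintegral_setU//.
- exact: measurableC.
- by apply: integrable_oneBcos; apply: measurableU => //; exact: measurableC.
- by apply/disj_set2P; rewrite setICr.
Qed.

Lemma levy_partE D (mD : measurable D) (nuD : (nu D < +oo)%E) v :
  levy_part D v = fine (nu D) - cosft (mfrestr mD nuD) v.
Proof.
have nuDf : nu D \is a fin_num by rewrite ge0_fin_numE.
have ic : (mfrestr mD nuD).-integrable setT (EFin \o (fun y => cos (dotp v y))).
  apply: (@integrable_bounded _ _ _ _ _ _ 1) => //.
  - exact: fin_num_fun_lty.
  - by apply: measurable_cosT; exact: measurable_dotp.
  - by move=> y; exact: cos_max.
have icD : nu.-integrable D (EFin \o (fun y => cos (dotp v y))).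
  apply: (@integrable_bounded _ _ _ _ _ _ 1) => //.
  - apply: measurable_funTS.
    by apply: measurable_cosT; exact: measurable_dotp.
  - by move=> y; exact: cos_max.
rewrite /levy_part RintegralB//; last first.
  apply: (@integrable_bounded _ _ _ nu D (fun=> 1) 1) => //.
  by move=> y; rewrite normr1.
rewrite Rintegral_cst// mul1r; congr (_ - _).
by rewrite /cosft /Rintegral integral_mfrestr.
Qed.

Lemma cvg_levy_part D v : measurable D ->
  levy_part (D `&` ~` eball 0 n.+1%:R^-1) v @[n --> \oo] --> levy_part D v.
Proof.
move=> mD.
pose f y := 1 - cos (dotp v y).
have mB n : measurable (~` eball (0 : V) n.+1%:R^-1).
  by apply: measurableC; exact: measurable_eball.
have fi := integrable_oneBcos v mD.
have mf := measurable_int _ fi.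
have mfn n : measurable_fun D (EFin \o (f \_ (~` eball 0 n.+1%:R^-1))).
  apply/measurable_EFinP; apply/measurable_restrict => //.
  apply: measurable_funS mD _ _ => //.
  exact/measurable_EFinP.
have [|||_ _ +] := @dominated_convergence _ _ R nu D mD
  (fun n => EFin \o (f \_ (~` eball 0 n.+1%:R^-1))) (EFin \o f)
  (EFin \o f) mfn mf.
- apply: aeW => y Dy; apply: cvg_EFin; first exact: nearW.
  (* The origin is removed at every stage, but 1 - cos vanishes there, so the limit is still
     right. *)
  have [y0|y0] := eqVneq y 0.
    rewrite y0 /f dotp0r cos0 subrr; apply: cvg_near_cst; apply: nearW => n /=.
    by rewrite /patch dotp0r cos0 subrr; case: ifP.
  apply: cvg_near_cst.
  have e0 : 0 < enorm y.
    by rewrite lt_neqAle enorm_ge0 andbT eq_sym; apply: contra_neq y0 => /enorm_eq0.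
  near=> n; rewrite /= /patch ifT// inE /eball/= subr0; apply/negP.
  rewrite -leNgt ltW//; near: n; exact: near_infty_natSinv_lt (PosNum e0).
- exact: fi.
- apply: aeW => y n _; rewrite /= lee_fin /patch; case: ifP => _.
    by rewrite ger0_norm// oneBcos_ge0.
  by rewrite normr0 oneBcos_ge0.
- move=> H; rewrite /levy_part; apply: fine_cvg; rewrite fineK; last first.
    exact: integrable_fin_num.
  rewrite (_ : (fun n => _) = (fun n =>
      \int[nu]_(x in D) (EFin \o f \_ (~` eball 0 n.+1%:R^-1)) x)%E)//.
  apply/funext => n; rewrite integral_mkcondr.
  by apply: eq_integral => y _; rewrite restrict_EFin.
Unshelve. all: by end_near. Qed.

End levy_exponent_theory.

(** * Positive definiteness of the exponentials of truncated exponents *)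

Section levy_multipliers.
Context {R : realType} {d : nat}.
Local Notation V := 'rV[R]_d.
Variable nu : {measure set V -> \bar R}.
Hypothesis hnu : levy_measure nu.
Variables (m : {sigma_finite_measure set V -> \bar R}) (w : V -> R).
Hypothesis iw : m.-integrable setT (EFin \o w).
Hypothesis w_posdef : posdef m w (cst 1).

(** Compound Poisson case: the multiplier is the constant exp(-t nu(D)) times the exponential of t
    times the cosine transform of [nu] restricted to [D]. *)
Lemma posdef_levy_finite (D : set V) (t : R) : measurable D ->
  (nu D < +oo)%E -> 0 <= t ->
  posdef m w (fun v => expR (- (t * levy_part nu D v))).
Proof.
move=> mD nuD t0.
have -> : (fun v => expR (- (t * levy_part nu D v))) =
    (fun v => expR (- (t * fine (nu D))) *
      (1 * expR (t * cosft (mfrestr mD nuD) v))).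
  by apply/funext => v; rewrite (levy_partE mD nuD) mul1r -expRD; congr expR; ring.
apply: (posdefZ iw); first exact: expR_ge0.
exact: (posdef_expM iw (mfrestr mD nuD) t0 w_posdef).
Qed.

(** Cutting out small balls around the origin gives finite measures; the multipliers stay in [0, 1]
    and converge pointwise. *)
Lemma posdef_levy (D : set V) (t : R) : measurable D -> 0 <= t ->
  posdef m w (fun v => expR (- (t * levy_part nu D v))).
Proof.
move=> mD t0.
pose D_ n := D `&` ~` eball (0 : V) n.+1%:R^-1.
have mD_ n : measurable (D_ n).
  by apply: measurableI => //; apply: measurableC; exact: measurable_eball.
apply: (posdef_lim iw (g_ := fun n v => expR (- (t * levy_part nu (D_ n) v)))
  (B := 1)).
- move=> n; apply: posdef_levy_finite => //.
  have n0 : 0 < n.+1%:R^-1 :> R by rewrite invr_gt0.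
  apply: le_lt_trans (levy_tail_lty hnu n0).
  apply: le_measure; rewrite ?inE//.
    by apply: measurableC; exact: measurable_eball.
  exact: subIsetr.
- move=> n v; rewrite ger0_norm ?expR_ge0// -expR0 ler_expR oppr_le0.
  by rewrite mulr_ge0// levy_part_ge0.
- move=> v; apply: continuous_cvg; first exact: continuous_expR.
  apply: cvgN; apply: cvgM; first exact: cvg_cst.
  exact: cvg_levy_part.
Qed.

End levy_multipliers.

(** * Upper bound of the exponent from the tail bound *)

Section levy_scaling.
Context {R : realType} {d : nat}.
Local Notation V := 'rV[R]_d.
Variable nu : {measure set V -> \bar R}.
Hypothesis hnu : levy_measure nu.
Variables (alpha c2 : R).
Hypotheses (halpha : 0 < alpha < 2) (hc2 : 0 < c2).
Hypothesis htail : forall r : R, 0 < r < 1 ->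
  (nu (~` eball 0 r) <= (c2 * r `^ (- alpha))%:E)%E.

Let I (r : R) := \int[nu]_y Num.min 1 (enorm y ^+ 2 / r ^+ 2).

(* Iterated, this sums the tail bounds of the Levy measure over dyadic shells. *)
Lemma min_sqr_half (r : R) (y : V) : 0 < r ->
  Num.min 1 (enorm y ^+ 2 / r ^+ 2) <=
  \1_(~` eball (0 : V) (r / 2)) y + Num.min 1 (enorm y ^+ 2 / (r / 2) ^+ 2) / 4.
Proof.
move=> r0; rewrite indicE.
have r20 : 0 < r ^+ 2 by rewrite exprn_gt0.
have y0 := enorm_ge0 y.
have [|] := boolP (y \in ~` eball 0 (r / 2)) => yr.
  rewrite ge_min; apply/orP; left; rewrite lerDl divr_ge0//.
  by rewrite le_min ler01 divr_ge0// sqr_ge0.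
move: yr; rewrite notin_setE /eball/= subr0 => /contrapT yr.
have yr2 : enorm y ^+ 2 < (r / 2) ^+ 2.
  by rewrite ltrXn2r ?nnegrE// divr_ge0// ltW.
have r22 : (r / 2) ^+ 2 = r ^+ 2 / 4 by field.
have r40 : 0 < (r / 2) ^+ 2 by rewrite exprn_gt0// divr_gt0.
rewrite add0r !min_r.
- by rewrite r22 le_eqVlt; apply/orP; left; apply/eqP; field; rewrite gt_eqF.
- by rewrite ler_pdivrMr// mul1r ltW.
- rewrite ler_pdivrMr// mul1r ltW// (lt_le_trans yr2)// r22.
  by rewrite ler_pdivrMr// ler_peMr ?ltW// ltr1n.
Qed.

Let I_half r : 0 < r < 1 -> I r <= c2 * (r / 2) `^ (- alpha) + I (r / 2) / 4.
Proof.
move=> /andP[r0 r1]; have r20 : 0 < r / 2 by rewrite divr_gt0.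
have mD : measurable (~` eball (0 : V) (r / 2)).
  by apply: measurableC; exact: measurable_eball.
have nuD : (nu (~` eball 0 (r / 2)) <= (c2 * (r / 2) `^ (- alpha))%:E)%E.
  apply: htail; rewrite r20/= ltr_pdivrMr// (lt_trans r1)// mul1r ltr1n//.
have nuDoo := levy_tail_lty hnu r20.
have i1 : nu.-integrable setT (EFin \o \1_(~` eball (0 : V) (r / 2))).
  apply/integrableP; split; first by apply/measurable_EFinP.
  under eq_integral do rewrite /= ger0_norm//.
  by rewrite integral_indic// setIT.
have i2 := integrable_min_sqr hnu r20.
have i3 : nu.-integrable setT
    (EFin \o (fun y : V => Num.min 1 (enorm y ^+ 2 / (r / 2) ^+ 2) / 4)).
  by have := integrableZr measurableT 4^-1 i2; apply: eq_integrable.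
apply: (@le_trans _ _ (\int[nu]_y (\1_(~` eball (0 : V) (r / 2)) y +
    Num.min 1 (enorm y ^+ 2 / (r / 2) ^+ 2) / 4))).
  apply: le_Rintegral => //.
  - exact: integrable_min_sqr.
  - by have := integrableD measurableT i1 i3; apply: eq_integrable.
  - by move=> y _; exact: min_sqr_half.
rewrite RintegralD// RintegralZr// lerD2r.
rewrite /Rintegral integral_indic// setIT.
by rewrite -lee_fin fineK// ge0_fin_numE.
Qed.

(** Sum of the geometric series of ratio 2^alpha / 4 and first term c2 2^alpha that arises when
    [I_half] is iterated; the ratio is below 1 because alpha < 2. *)
Definition tail_const : R := c2 * 2 `^ alpha / (1 - 2 `^ alpha / 4).
Local Notation K := tail_const.

Let theta_lt1 : 2 `^ alpha / 4 < 1.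
Proof.
have /andP[a0 a2] := halpha.
rewrite ltr_pdivrMr// mul1r (_ : 4 = 2 `^ 2%:R); last by rewrite powR_mulrn// -natrX.
by rewrite /powR pnatr_eq0/= ltr_expR ltr_pM2r// ln_gt0// ltr1n.
Qed.

(** The constant is the fixed point K = c2 2^alpha + K 2^alpha / 4 of the recursion, so the main
    term reproduces itself exactly at each halving. *)
Let I_iter n r : 0 < r < 1 -> I r <= K * r `^ (- alpha) + I (r / 2 ^+ n) / 4 ^+ n.
Proof.
have K0 : 0 <= K.
  by rewrite /tail_const divr_ge0// ?mulr_ge0 ?powR_ge0// ?ltW// subr_gt0.
elim: n r => [|n IH] r r01.
  by rewrite !expr0 !divr1 lerDr mulr_ge0// powR_ge0.
have /andP[r0 r1] := r01.
have r20 : 0 < r / 2 by rewrite divr_gt0.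
have r201 : 0 < r / 2 < 1.
  by rewrite r20/= ltr_pdivrMr// (lt_trans r1)// mul1r ltr1n.
rewrite (le_trans (I_half r01))//.
have := IH _ r201; rewrite -(ler_pM2r (x := 4^-1)) ?invr_gt0//.
rewrite -(lerD2l (c2 * (r / 2) `^ (- alpha))) => /le_trans; apply.
rewrite le_eqVlt; apply/orP; left; apply/eqP.
have -> : r / 2 / 2 ^+ n = r / 2 ^+ n.+1.
  by rewrite exprS; field; rewrite expf_neq0.
rewrite powRM ?invr_ge0// ?(ltW r0)//.
have -> : 2^-1 `^ (- alpha) = 2 `^ alpha :> R.
  by rewrite -powR_inv1// -powRrM mulN1r opprK.
rewrite mulrDl addrA; congr (_ + _); last first.
  by rewrite [4 ^+ n.+1]exprSr invfM mulrA.
have hK : K * (1 - 2 `^ alpha / 4) = c2 * 2 `^ alpha.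
  by rewrite divfK// gt_eqF// subr_gt0.
transitivity (K * (1 - 2 `^ alpha / 4) * r `^ (- alpha)
    + K * (r `^ (- alpha) * 2 `^ alpha) / 4); last by ring.
by rewrite hK; ring.
Qed.

Lemma Rintegral_min_sqr_le r : 0 < r < 1 ->
  \int[nu]_y Num.min 1 (enorm y ^+ 2 / r ^+ 2) <= K * r `^ (- alpha).
Proof.
move=> r01; have /andP[r0 r1] := r01.
(* The remainder is rewritten with a truncation level 4^-n instead of a shrinking radius, so that
   dominated convergence sends it to 0. *)
have IE n : I (r / 2 ^+ n) / 4 ^+ n =
    \int[nu]_y Num.min (4 ^- n) (enorm y ^+ 2 / r ^+ 2).
  have rn : 0 < r / 2 ^+ n by rewrite divr_gt0// exprn_gt0.
  rewrite /I -RintegralZr//; last exact: integrable_min_sqr.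
  apply: eq_Rintegral => y _.
  rewrite minr_pMl ?invr_ge0 ?exprn_ge0// mul1r; congr Num.min.
  have -> : (4 : R) ^+ n = 2 ^+ n ^+ 2.
    by rewrite -exprM mulnC exprM; congr (_ ^+ _); ring.
  by field; rewrite !expf_neq0// gt_eqF.
have cI : I (r / 2 ^+ n) / 4 ^+ n @[n --> \oo] --> 0.
  under eq_fun do rewrite IE.
  pose f n (y : V) := Num.min (4 ^- n) (enorm y ^+ 2 / r ^+ 2).
  have mfn n : measurable_fun setT (EFin \o f n).
    by apply/measurable_EFinP; exact: measurable_min_sqr.
  have mf0 : measurable_fun [set: V] (cst 0 : V -> \bar R) by [].
  have p4 n : 0 <= 4 ^- n :> R by rewrite invr_ge0 exprn_ge0.
  have [|||_ _ +] := @dominated_convergence _ _ R nu setT measurableT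
    (fun n => EFin \o f n) (cst 0)
    (EFin \o (fun y : V => Num.min 1 (enorm y ^+ 2 / r ^+ 2))) mfn mf0.
  - apply: aeW => y _; apply: cvg_EFin; first exact: nearW.
    apply: (@squeeze_cvgr _ _ _ _ (cst 0) (fun n => (4^-1) ^+ n)).
    + apply: nearW => n; rewrite /= min_sqr_ge0//=.
      by rewrite ge_min exprVn lexx.
    + exact: cvg_cst.
    + by apply: cvg_expr; rewrite ger0_norm// invf_lt1// ltr1n.
  - exact: integrable_min_sqr.
  - apply: aeW => y n _; rewrite /= lee_fin ger0_norm ?min_sqr_ge0//.
    rewrite le_min ge_min [in X in _ && X]ge_min lexx orbT andbT.
    by rewrite invf_le1 ?exprn_gt0// exprn_ege1// ler1n.
  - rewrite integral0 => H; apply: fine_cvg; exact: H.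
rewrite -[leRHS]addr0.
have c : K * r `^ (- alpha) + I (r / 2 ^+ n) / 4 ^+ n @[n --> \oo] -->
    K * r `^ (- alpha) + 0 by apply: cvgD => //; exact: cvg_cst.
apply: (cvgr_to_ge c).
by apply: nearW => n; exact: I_iter.
Qed.

(** Since |v.y| <= s |y|/r, the integrand 1 - cos(v.y) is at most (2 + s^2) min(1, |y|^2/r^2). *)
Lemma levy_exponent_le (s r : R) (v : V) : 0 < r < 1 -> enorm v * r <= s ->
  levy_exponent nu v <= (2 + s ^+ 2) * K * r `^ (- alpha).
Proof.
move=> r01 vs; have /andP[r0 r1] := r01.
have i1 := integrable_min_sqr hnu r0.
rewrite -mulrA; apply: (@le_trans _ _ ((2 + s ^+ 2) * I r)); last first.
  by rewrite ler_wpM2l ?addr_ge0 ?sqr_ge0// Rintegral_min_sqr_le.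
rewrite /I -RintegralZl//; apply: le_Rintegral => //.
- exact: integrable_oneBcos.
- by have := integrableZl measurableT (2 + s ^+ 2) i1; apply: eq_integrable.
move=> y _.
have [u1|u1] := leP 1 (enorm y ^+ 2 / r ^+ 2).
  by rewrite mulr1 (le_trans (oneBcos_le2 _))// lerDl sqr_ge0.
rewrite (le_trans (oneBcos_le _))//.
have h1 : dotp v y ^+ 2 <= enorm v ^+ 2 * enorm y ^+ 2.
  by rewrite !sqr_enorm dotp_sqr_le.
set u := enorm y ^+ 2 / r ^+ 2.
have u0 : 0 <= u by rewrite divr_ge0// sqr_ge0.
have h2 : enorm v ^+ 2 * enorm y ^+ 2 = (enorm v * r) ^+ 2 * u.
  by rewrite /u; field; rewrite gt_eqF.
have h3 : (enorm v * r) ^+ 2 <= s ^+ 2.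
  have vr0 : 0 <= enorm v * r by rewrite mulr_ge0 ?enorm_ge0 ?(ltW r0).
  by rewrite lerXn2r ?nnegrE// (le_trans vr0).
have h4 : (enorm v * r) ^+ 2 * u <= s ^+ 2 * u by rewrite ler_wpM2r.
have h5 : 0 <= s ^+ 2 * u by rewrite mulr_ge0// sqr_ge0.
rewrite mulrDl; lra.
Qed.

End levy_scaling.

(** * Lower bound near the diagonal *)

Section near_diagonal.
Context {R : realType}.
Local Notation mu := (@lebesgue_measure R).

Lemma poly_le_expR (alpha c0 : R) (d : nat) : 0 < alpha -> 0 < c0 ->
  exists2 C : R, 0 < C & forall u, 0 <= u ->
    u ^+ 2 * (1 + u ^+ 2) ^+ d <= C * expR (c0 * u `^ alpha).
Proof.
move=> a0 c00.
(* For u > 1 the left side is at most 2^d u^(2(d+1)); one Taylor term of the exponential, of order n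
   + 1 with alpha (n + 1) > 2(d + 1), dominates it. *)
have [n hn] : exists n : nat, (2 * d.+1)%:R / alpha < n.+1%:R.
  exists (Num.trunc ((2 * d.+1)%:R / alpha)); exact: truncnS_gt.
(* The summand 1 covers u <= 1; the other one inverts the coefficient of the retained Taylor
   term. *)
exists (2 ^+ d * (1 + n.+1`!%:R / c0 ^+ n.+1)).
  by rewrite mulr_gt0 ?exprn_gt0// ltr_wpDr// divr_ge0 ?exprn_ge0// ltW.
move=> u u0.
have E1 : 1 <= expR (c0 * u `^ alpha).
  by rewrite -expR0 ler_expR mulr_ge0 ?powR_ge0// ltW.
have F0 : 0 <= n.+1`!%:R / c0 ^+ n.+1 by rewrite divr_ge0 ?exprn_ge0// ltW.
have [u1|u1] := leP u 1.
  apply: (@le_trans _ _ (2 ^+ d * 1 * 1)); last first.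
    rewrite ler_pM// ?mulr_ge0 ?exprn_ge0//.
    by rewrite ler_wpM2l ?exprn_ge0// lerDl.
  rewrite !mulr1 -[leRHS]mul1r ler_pM ?exprn_ge0 ?addr_ge0 ?sqr_ge0//.
    by rewrite exprn_ile1.
  rewrite lerXn2r ?nnegrE ?addr_ge0 ?sqr_ge0//.
  by rewrite -[2]/(1 + 1) lerD2l exprn_ile1.
apply: (@le_trans _ _ (2 ^+ d * u ^+ (2 * d.+1))).
  apply: (@le_trans _ _ (u ^+ 2 * (2 * u ^+ 2) ^+ d)).
    rewrite ler_wpM2l ?sqr_ge0// lerXn2r ?nnegrE ?addr_ge0 ?mulr_ge0 ?sqr_ge0//.
    by rewrite mulr_natl mulr2n lerD2r exprn_ege1// ltW.
  by rewrite exprMn -exprM mulrCA -exprD mulnS.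
rewrite -mulrA ler_wpM2l ?exprn_ge0//.
apply: (@le_trans _ _ ((u `^ alpha) ^+ n.+1)).
  rewrite -!powR_mulrn ?powR_ge0// -powRrM ler_powR ?(ltW u1)//.
  by move: hn; rewrite ltr_pdivrMr// mulrC => /ltW.
have x0 : 0 <= c0 * u `^ alpha by rewrite mulr_ge0 ?powR_ge0// ltW.
have := expR_ge1Dxn n x0; rewrite exprMn => h.
have h2 : c0 ^+ n.+1 * (u `^ alpha) ^+ n.+1 / n.+1`!%:R <= expR (c0 * u `^ alpha).
  by rewrite (le_trans _ h)// lerDr.
rewrite mulrDl mul1r -[leLHS]add0r lerD ?expR_ge0//.
rewrite mulrAC ler_pdivlMr ?exprn_gt0// mulrC.
by move: h2; rewrite ler_pdivrMr ?ltr0n ?fact_gt0// [X in _ <= X -> _]mulrC.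
Qed.

Lemma integrable_prod_rV d (f : 'I_d -> R -> R) (I : 'I_d -> R) :
  (forall i, measurable_fun setT (f i)) -> (forall i u, 0 <= f i u) ->
  (forall i, (\int[mu]_u (f i u)%:E = (I i)%:E)%E) ->
  (lebesgue_rV d).-integrable setT
    (EFin \o (fun v => \prod_i f i (v ord0 i))) /\
  \int[lebesgue_rV d]_v (\prod_i f i (v ord0 i)) = \prod_i I i.
Proof.
move=> mf f0 fI; split; last by rewrite /Rintegral (ge0_integral_prod_rV mf f0 fI).
apply/integrableP; split.
  apply/measurable_EFinP; apply: measurable_prod => i _.
  by apply: (measurableT_comp (mf i)); exact: measurable_coord.
under eq_integral do rewrite /= ger0_norm ?prodr_ge0//.
by rewrite (ge0_integral_prod_rV mf f0 fI) ltry.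
Qed.

(** Product of Cauchy kernels of width 1/s centred at x, unnormalized, of total mass pi^d. It serves
    as integrable majorant (s = tau, x = 0) and as approximate identity (s = 1/e). *)
Definition cauchy_rV d (s : R) (x v : 'rV[R]_d) : R :=
  \prod_i (s / oneDsqr (s * (v ord0 i - x ord0 i))).

Lemma measurable_cauchy (s a : R) :
  measurable_fun setT (fun u : R => s / oneDsqr (s * (u - a))).
Proof.
apply: measurable_funM => //.
apply: (@measurableT_comp _ _ _ _ _ _ (fun y => (oneDsqr y)^-1)).
  exact: (continuous_measurable_fun (@continuous_oneDsqrV R)).
by apply: measurable_funM => //; exact: measurable_funB.
Qed.

Lemma cauchy_ge0 (s a u : R) : 0 < s -> 0 <= s / oneDsqr (s * (u - a)).
Proof. by move=> s0; rewrite divr_ge0// ?(ltW s0)// (le_trans ler01)// oneDsqr_ge1. Qed.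

Lemma integrable_cauchy_rV d (s : R) (x : 'rV[R]_d) : 0 < s ->
  (lebesgue_rV d).-integrable setT (EFin \o cauchy_rV s x) /\
  \int[lebesgue_rV d]_v cauchy_rV s x v = pi ^+ d.
Proof.
move=> s0.
have [] := @integrable_prod_rV d
  (fun i u => s / oneDsqr (s * (u - x ord0 i))) (fun=> pi).
- by move=> i; exact: measurable_cauchy.
- by move=> i u; exact: cauchy_ge0.
- by move=> i; exact: integralT_cauchy.
by move=> i1 ->; split => //; rewrite prodr_const card_ord.
Qed.

Definition cube_indic d (a : R) (v : 'rV[R]_d) : R :=
  \prod_i \1_(`[- a, a]%classic) (v ord0 i).

Lemma integrable_cube d (a : R) : 0 < a ->
  (lebesgue_rV d).-integrable setT (EFin \o cube_indic a) /\
  \int[lebesgue_rV d]_v cube_indic a v = (2 * a) ^+ d.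
Proof.
move=> a0.
have [] := @integrable_prod_rV d
  (fun _ => \1_(`[- a, a]%classic)) (fun=> 2 * a).
- by move=> i.
- by move=> i u; rewrite indicE.
- move=> i; rewrite integral_indic//= setIT lebesgue_measure_itv/= lte_fin gtrN//.
  by rewrite -EFinB opprK mulr_natl mulr2n.
by move=> i1 ->; split => //; rewrite prodr_const card_ord.
Qed.

End near_diagonal.

(** * Lower bound of the transform at points of size comparable to tau *)

Section near_diagonal_lower_bound.
Context {R : realType} (d : nat).
Local Notation V := 'rV[R]_d.
Local Notation L := (lebesgue_rV d).
Variables (alpha c0 Lam S : R).
Hypotheses (a0 : 0 < alpha) (c00 : 0 < c0).

(** With u = tau |v|, clearing the Cauchy denominators costs at most (1 + u^2)^d, and [poly_le_expR]
    absorbs the resulting polynomial. For |v| <= 1, where no growth of [Psi] is assumed, u <= 1 and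
    [Psi] >= 0 suffice. The constant does not depend on [tau] or [Psi]. *)
Lemma expR_cauchy_bound : exists2 C : R, 0 < C &
  forall (tau : R) (Psi : V -> R), 0 < tau < 1 -> (forall v, 0 <= Psi v) ->
  (forall v, 1 < enorm v -> c0 * (tau * enorm v) `^ alpha - Lam <= Psi v) ->
  forall v, expR (- Psi v) * (tau * enorm v) ^+ 2 <=
    C / tau ^+ d * cauchy_rV tau 0 v.
Proof.
have [C1 C10 hC1] := @poly_le_expR R alpha c0 d a0 c00.
exists (2 ^+ d + expR Lam * C1).
  by rewrite addr_gt0 ?exprn_gt0// mulr_gt0 ?expR_gt0.
move=> tau Psi /andP[t0 t1] Psi0 hPsi v.
pose u := tau * enorm v.
have u0 : 0 <= u by rewrite mulr_ge0 ?enorm_ge0// ltW.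
have [prod_gt0 prod_le] : 0 < \prod_i oneDsqr (tau * v ord0 i) /\
    \prod_i oneDsqr (tau * v ord0 i) <= (1 + u ^+ 2) ^+ d.
  split; first by apply: prodr_gt0 => i _; rewrite (lt_le_trans ltr01)// oneDsqr_ge1.
  rewrite -[X in _ ^+ X]card_ord -prodr_const; apply: ler_prod => i _.
  rewrite (le_trans ler01) ?oneDsqr_ge1//= /oneDsqr lerD2l.
  rewrite -real_normK ?num_real// lerXn2r ?nnegrE//.
  by rewrite normrM gtr0_norm// ler_wpM2l ?norm_coord_le// ltW.
have -> : cauchy_rV tau 0 v = tau ^+ d / \prod_i oneDsqr (tau * v ord0 i).
  rewrite /cauchy_rV big_split/= prodr_const card_ord; congr (_ * _).
  by rewrite prodfV; congr (_^-1); apply: eq_bigr => i _; rewrite mxE subr0.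
rewrite mulrA divfK ?expf_neq0 ?gt_eqF// -/u ler_pdivlMr//.
apply: (@le_trans _ _ (expR (- Psi v) * (u ^+ 2 * (1 + u ^+ 2) ^+ d))).
  by rewrite -mulrA ler_wpM2l ?expR_ge0// ler_wpM2l// sqr_ge0.
have [v1|v1] := leP (enorm v) 1.
  have u1 : u <= 1 by rewrite mulr_ile1 ?enorm_ge0// ltW.
  apply: (@le_trans _ _ (2 ^+ d)); last first.
    by rewrite lerDl mulr_ge0 ?expR_ge0// ltW.
  rewrite -[leRHS]mul1r ler_pM ?expR_ge0//.
  - by rewrite mulr_ge0 ?exprn_ge0 ?addr_ge0 ?sqr_ge0.
  - by rewrite -expR0 ler_expR oppr_le0.
  - rewrite -[leRHS]mul1r ler_pM ?exprn_ge0 ?addr_ge0 ?sqr_ge0//.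
      by rewrite exprn_ile1.
    rewrite lerXn2r ?nnegrE ?addr_ge0 ?sqr_ge0//.
    by rewrite -[2]/(1 + 1) lerD2l exprn_ile1.
apply: (@le_trans _ _ (expR Lam * C1)); last by rewrite lerDr exprn_ge0.
have h : expR (- Psi v) <= expR Lam * expR (- (c0 * u `^ alpha)).
  by rewrite -expRD ler_expR; have := hPsi v v1; rewrite -/u; lra.
apply: (@le_trans _ _ (expR Lam * expR (- (c0 * u `^ alpha)) *
    (C1 * expR (c0 * u `^ alpha)))).
  rewrite ler_pM ?expR_ge0 ?hC1//.
  by rewrite mulr_ge0 ?exprn_ge0 ?addr_ge0 ?sqr_ge0.
by rewrite mulrACA -mulrA -expRD addrC subrr expR0 mulr1.
Qed.

(** On the cube e |v_i| <= e / tau <= 1, so the weight is at least exp(-d) there, and exp(-Psi) is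
    at least exp(-S). *)
Lemma laplace_expR_cube (tau e : R) (Psi : V -> R) : 0 < tau -> 0 < e <= tau ->
  (forall v : V, (forall i, `|v ord0 i| <= tau^-1) -> Psi v <= S) ->
  forall v, expR (- (d%:R + S)) * cube_indic tau^-1 v <=
    laplace_rV e v * expR (- Psi v).
Proof.
move=> t0 /andP[e0 et] hS v.
have [h|] := pselect (forall i, `|v ord0 i| <= tau^-1).
  have -> : cube_indic tau^-1 v = 1.
    rewrite /cube_indic big1// => i _; rewrite indicE mem_set//=.
    by rewrite in_itv/= -ler_norml.
  rewrite mulr1 opprD expRD ler_pM ?expR_ge0//; last by rewrite ler_expR lerN2 hS.
  rewrite -mulrN1 expRM_natl -[X in _ ^+ X]card_ord -prodr_const.
  apply: ler_prod => i _; rewrite expR_ge0 ler_expR lerN2.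
  rewrite (@le_trans _ _ (e * tau^-1))//; first by rewrite ler_pM2l.
  by rewrite ler_pdivrMr// mul1r.
move=> /existsNP[i hi].
rewrite /cube_indic (bigD1 i)//= indicE memNset; last first.
  by rewrite /= in_itv/= -ler_norml.
by rewrite mul0r mulr0 mulr_ge0 ?expR_ge0// laplace_rV_ge0.
Qed.

(** Write cos(v.z) = 1 - (1 - cos(v.z)). The term 1 contributes at least D tau^(-d), from the cube;
    the error is at most half of |v|^2 |z|^2 exp(-Psi), whose integral the Cauchy majorant bounds by
    a multiple of (|z|/tau)^2 tau^(-d). All constants are uniform in [tau], [e] and [Psi]. *)
Lemma wft_near_diagonal : exists2 c : R, 0 < c &
  exists2 rho : R, 0 < rho &
  forall (tau e : R) (Psi : V -> R), 0 < tau < 1 -> 0 < e <= tau ->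
  measurable_fun setT (fun v => expR (- Psi v)) -> (forall v, 0 <= Psi v) ->
  (forall v, 1 < enorm v -> c0 * (tau * enorm v) `^ alpha - Lam <= Psi v) ->
  (forall v : V, (forall i, `|v ord0 i| <= tau^-1) -> Psi v <= S) ->
  forall z : V, enorm z <= rho * tau ->
    c / tau ^+ d <= wft L (laplace_rV e) (fun v => expR (- Psi v)) z.
Proof.
have [C C0 hC] := expR_cauchy_bound.
pose D := expR (- (d%:R + S)) * 2 ^+ d.
have D0 : 0 < D by rewrite mulr_gt0 ?expR_gt0// exprn_gt0.
have pi0 := @pi_gt0 R.
exists (D / 2); first by rewrite divr_gt0.
(* This radius satisfies rho^2 C pi^d = D, so the error takes at most half of the main term. *)
exists (Num.sqrt (D / (C * pi ^+ d))).
  by rewrite sqrtr_gt0 divr_gt0// mulr_gt0// exprn_gt0.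
move=> tau e Psi t01 e0t mg Psi0 hlow hup z hz.
have /andP[t0 t1] := t01; have /andP[e0 et] := e0t.
have hz2 : (enorm z / tau) ^+ 2 * (C * pi ^+ d) <= D.
  rewrite -ler_pdivlMr ?mulr_gt0 ?exprn_gt0//.
  have q0 : 0 <= D / (C * pi ^+ d).
    by rewrite ltW// divr_gt0// mulr_gt0// exprn_gt0.
  rewrite -[leRHS](sqr_sqrtr q0) lerXn2r ?nnegrE ?sqrtr_ge0//.
    by rewrite divr_ge0 ?enorm_ge0// ltW.
  by rewrite ler_pdivrMr.
have ti0 : 0 < tau^-1 by rewrite invr_gt0.
have [ic cE] := @integrable_cube R d _ ti0.
have [ik kE] := @integrable_cauchy_rV R d tau 0 t0.
pose k1 := expR (- (d%:R + S)).
pose k2 := (enorm z / tau) ^+ 2 / 2 * (C / tau ^+ d).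
have i1 : L.-integrable setT (EFin \o (fun v => k1 * cube_indic tau^-1 v)).
  by have := integrableZl measurableT k1 ic; apply: eq_integrable.
have i2 : L.-integrable setT (EFin \o (fun v => k2 * cauchy_rV tau 0 v)).
  by have := integrableZl measurableT k2 ik; apply: eq_integrable.
have gB v : `|expR (- Psi v)| <= 1.
  by rewrite ger0_norm ?expR_ge0// -expR0 ler_expR oppr_le0.
apply: (@le_trans _ _ (\int[L]_v (k1 * cube_indic tau^-1 v - k2 * cauchy_rV tau 0 v))).
  rewrite RintegralB// !RintegralZl// cE kE /k1 /k2.
  rewrite exprMn exprVn [_ * (2 ^+ d / _)]mulrA -/D.
  have -> : (enorm z / tau) ^+ 2 / 2 * (C / tau ^+ d) * pi ^+ d =
      (enorm z / tau) ^+ 2 * (C * pi ^+ d) / 2 / tau ^+ d by ring.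
  rewrite -mulrBl ler_pM2r ?invr_gt0 ?exprn_gt0//.
  lra.
apply: le_Rintegral => //.
- by have := integrableB measurableT i1 i2; apply: eq_integrable.
- exact: (integrable_wft (integrable_laplace_rV d e0) z mg gB).
move=> v _.
have l0 := laplace_rV_ge0 e v; have l1 := laplace_rV_le1 v (ltW e0).
have h1 := laplace_expR_cube t0 e0t hup v.
have h2 := hC tau Psi t01 Psi0 hlow v.
have h3 := oneBcos_le (dotp v z).
have h4 : dotp v z ^+ 2 <= enorm v ^+ 2 * enorm z ^+ 2.
  by rewrite !sqr_enorm dotp_sqr_le.
have g0 := expR_ge0 (- Psi v).
have h5 : laplace_rV e v * expR (- Psi v) * (1 - cos (dotp v z)) <=
    k2 * cauchy_rV tau 0 v.
  apply: (@le_trans _ _ (1 * expR (- Psi v) * (enorm v ^+ 2 * enorm z ^+ 2 / 2))).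
    rewrite ler_pM ?mulr_ge0 ?oneBcos_ge0// ?ler_wpM2r//.
    by rewrite (le_trans h3)// ler_pM2r ?invr_gt0.
  rewrite (_ : _ * _ = (enorm z / tau) ^+ 2 / 2 *
      (expR (- Psi v) * (tau * enorm v) ^+ 2)); last first.
    by field; rewrite gt_eqF.
  by rewrite /k2 -[leRHS]mulrA ler_wpM2l// divr_ge0// sqr_ge0.
have -> : laplace_rV e v * (expR (- Psi v) * cos (dotp v z)) =
  laplace_rV e v * expR (- Psi v) -
  laplace_rV e v * expR (- Psi v) * (1 - cos (dotp v z)) by ring.
exact: lerB.
Qed.

End near_diagonal_lower_bound.

(** * Cauchy kernels as an approximate identity *)

Section change_of_density.
Context d (T : measurableType d) (R : realType).
Variables (nu mu : {measure set T -> \bar R}) (f : T -> R).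
Hypotheses (mf : measurable_fun setT f) (f0 : forall x, 0 <= f x).
Hypothesis nuf : forall B, measurable B -> (nu B = \int[mu]_(x in B) (f x)%:E)%E.

Import HBNNSimple.

(** Passage from sets to simple functions by linearity, then to nonnegative functions by monotone
    convergence. *)
Lemma ge0_integral_density (k : T -> R) : measurable_fun setT k ->
  (forall x, 0 <= k x) ->
  (\int[nu]_x (k x)%:E = \int[mu]_x (f x * k x)%:E)%E.
Proof.
move=> mk k0.
have mkE : measurable_fun setT (EFin \o k) by exact/measurable_EFinP.
have mfE : measurable_fun setT (EFin \o f) by exact/measurable_EFinP.
pose h := nnsfun_approx measurableT mkE.
have hk x : (EFin \o h n) x @[n --> \oo] --> (k x)%:E.
  by apply: (@cvg_nnsfun_approx _ _ _ setT measurableT (EFin \o k)) => // *; rewrite lee_fin.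
have -> : (\int[nu]_x (k x)%:E = limn (fun n => \int[nu]_x (EFin \o h n) x))%E.
  under eq_integral => x _ do rewrite -(cvg_lim _ (hk x))//.
  apply: monotone_convergence => //.
  - by move=> n; apply/measurable_EFinP.
  - by move=> n x _; rewrite lee_fin.
  - by move=> x _ a b ab; rewrite lee_fin; exact/lefP/nd_nnsfun_approx.
have -> : (\int[mu]_x (f x * k x)%:E =
    limn (fun n => \int[mu]_x ((f x)%:E * (EFin \o h n) x)))%E.
  have hfk x : ((f x)%:E * (EFin \o h n) x)%E @[n --> \oo] --> (f x * k x)%:E.
    by rewrite EFinM; apply: cvgeZl => //; exact: hk.
  under eq_integral => x _ do rewrite -(cvg_lim _ (hfk x))//.
  apply: monotone_convergence => //.
  - by move=> n; apply/measurable_EFinP; exact: measurable_funM.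
  - by move=> n x _; rewrite lee_fin mulr_ge0.
  - by move=> x _ a b ab; rewrite lee_fin ler_wpM2l//; exact/lefP/nd_nnsfun_approx.
congr (limn _); apply/funext => n.
transitivity (\int[nu]_x
   (\sum_(y \in range (h n)) (y * \1_(h n @^-1` [set y]) x)%:E))%E.
  by apply: eq_integral => t tE; rewrite /= fimfunE -fsumEFin.
rewrite ge0_integral_fsum//; last 2 first.
- by move=> y; apply/measurable_EFinP; exact: measurable_funM.
- by move=> m y Ey; exact: nnfun_muleindic_ge0.
transitivity (\int[mu]_x (\sum_(y \in range (h n))
    ((f x)%:E * (y * \1_(h n @^-1` [set y]) x)%:E)))%E; last first.
  apply: eq_integral => x _; rewrite -ge0_mule_fsumr => [|y]; last first.
    exact: nnfun_muleindic_ge0.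
  by rewrite fsumEFin// -(fimfunE _ x).
rewrite ge0_integral_fsum//; last 2 first.
- move=> y; apply/measurable_EFinP; apply: measurable_funM => //.
  exact: measurable_funM.
- move=> m y Ey; apply: mule_ge0; first by rewrite lee_fin.
  exact: nnfun_muleindic_ge0.
apply: eq_fsbigr => r rhn.
under [LHS]eq_integral do rewrite EFinM.
rewrite integralZl_indic_nnsfun// integral_indic// setIT nuf//.
under [RHS]eq_integral do rewrite -EFinM mulrCA EFinM.
have r0 : 0 <= r by move: rhn; rewrite inE => -[x _ <-].
rewrite ge0_integralZl//.
- congr (_ * _)%E; rewrite integral_mkcond; apply: eq_integral => x _.
  by rewrite /patch indicE; case: ifP => _; rewrite ?mulr1 ?mulr0.
- by apply/measurable_EFinP; exact: measurable_funM.
- by move=> x _; rewrite lee_fin mulr_ge0.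
Qed.

End change_of_density.

(** * Convergence of Cauchy averages to point values *)

Section cauchy_approximation.
Context {R : realType} (d : nat).
Local Notation V := 'rV[R]_d.
Local Notation L := (lebesgue_rV d).

(** The kernel of width e is at most e / u^2, and 1 / u^2 <= (1 + delta^(-2)) / (1 + u^2) once |u|
    >= delta. *)
Lemma cauchy_tail (e delta u : R) : 0 < e -> 0 < delta -> delta <= `|u| ->
  e^-1 / oneDsqr (e^-1 * u) <= e * (1 + delta ^- 2) * (1 / oneDsqr (1 * u)).
Proof.
move=> e0 d0 du.
have d2 : delta ^+ 2 <= u ^+ 2.
  by rewrite -[leRHS]real_normK ?num_real// lerXn2r ?nnegrE// ltW.
have dp : 0 < delta ^+ 2 by rewrite exprn_gt0.
have u2 : 0 < u ^+ 2 := lt_le_trans dp d2.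
rewrite !mul1r /oneDsqr.
apply: (@le_trans _ _ (e / u ^+ 2)).
  rewrite ler_pdivlMr// mulrAC ler_pdivrMr; last first.
    by rewrite ltr_pwDl// sqr_ge0.
  rewrite (_ : e * _ = e + e^-1 * u ^+ 2); last by field; rewrite gt_eqF.
  by rewrite lerDr ltW.
rewrite -mulrA ler_pM2l// -[leLHS]mul1r ler_pdivlMr; last by rewrite ltr_pwDl// ltW.
rewrite mul1r mulrC mulrDl mul1r mulfV ?gt_eqF// addrC lerD2l.
by rewrite lef_pV2.
Qed.

(* Majorizes cauchy_rV, up to a factor O(1/s), on the set of those v that stay
   away from x in the j-th coordinate. *)
Definition mixed_cauchy (s : R) (x v : V) (j : 'I_d) : R :=
  \prod_i ((if i == j then 1 else s) /
    oneDsqr ((if i == j then 1 else s) * (v ord0 i - x ord0 i))).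

Lemma integrable_mixed_cauchy (s : R) (x : V) (j : 'I_d) : 0 < s ->
  L.-integrable setT (EFin \o (fun v => mixed_cauchy s x v j)) /\
  \int[L]_v mixed_cauchy s x v j = pi ^+ d.
Proof.
move=> s0; have sj0 i : 0 < if i == j then 1 else s by case: ifP.
have [] := @integrable_prod_rV R d (fun i u => (if i == j then 1 else s) /
    oneDsqr ((if i == j then 1 else s) * (u - x ord0 i))) (fun=> pi).
- by move=> i; exact: measurable_cauchy.
- by move=> i u; exact: cauchy_ge0.
- by move=> i; exact: integralT_cauchy.
by move=> i1 ->; split => //; rewrite prodr_const card_ord.
Qed.

Lemma cauchy_rV_ge0 (s : R) (x v : V) : 0 < s -> 0 <= cauchy_rV s x v.
Proof. by move=> s0; apply: prodr_ge0 => i _; exact: cauchy_ge0. Qed.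

Lemma mixed_cauchy_ge0 (s : R) (x v : V) j : 0 < s -> 0 <= mixed_cauchy s x v j.
Proof.
by move=> s0; apply: prodr_ge0 => i _; apply: cauchy_ge0; case: ifP.
Qed.

Lemma cauchy_rV_tail (e delta : R) (x v : V) (j : 'I_d) : 0 < e -> 0 < delta ->
  delta <= `|v ord0 j - x ord0 j| ->
  cauchy_rV e^-1 x v <= e * (1 + delta ^- 2) * mixed_cauchy e^-1 x v j.
Proof.
move=> e0 d0 h; rewrite /cauchy_rV /mixed_cauchy (bigD1 j)//= [in leRHS](bigD1 j)//=.
have ei0 : 0 < e^-1 by rewrite invr_gt0.
rewrite eqxx mulrA.
rewrite [X in _ <= _ * X](eq_bigr (fun i =>
    e^-1 / oneDsqr (e^-1 * (v ord0 i - x ord0 i)))); last first.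
  by move=> i /negbTE ->.
rewrite ler_wpM2r ?cauchy_tail//.
by apply: prodr_ge0 => i _; exact: cauchy_ge0.
Qed.

(** Near x, f is at most f(x) plus a small error. A point outside the sup-norm ball is far from x in
    some coordinate j, where f <= M and the kernel is O(e) times an integrable mixed kernel; summing
    over j gives O(e). *)
Lemma cauchy_approx_le (f : V -> R) (M B : R) (x : V) (e0 : R) :
  measurable_fun setT f -> (forall y, 0 <= f y <= M) ->
  {for x, continuous f} -> 0 < e0 ->
  (forall e, 0 < e <= e0 ->
    B <= \int[L]_y (f y * cauchy_rV e^-1 x y)) ->
  B <= pi ^+ d * f x.
Proof.
move=> mf fM cf e00 hB.
have fb y : `|f y| <= M by have /andP[? ?] := fM y; rewrite ger0_norm.
have M0 : 0 <= M by have /andP[? ?] := fM x; exact: le_trans (_ : 0 <= f x) _.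
have pid : 0 < pi ^+ d :> R by rewrite exprn_gt0// pi_gt0.
apply/ler_addgt0Pr => eta eta0.
have eta2 : 0 < eta / 2 / pi ^+ d by rewrite !divr_gt0.
have /nbhs_ballP[delta /= delta0 hdelta] :
    nbhs x [set y | f y <= f x + eta / 2 / pi ^+ d].
  have lt_fx : f x < f x + eta / 2 / pi ^+ d by rewrite ltrDl.
  exact: (@cvgr_le _ _ _ _ f (f x) cf _ lt_fx).
pose D := M * (1 + delta ^- 2) * d%:R * pi ^+ d.
have D0 : 0 <= D.
  by rewrite !mulr_ge0// ?addr_ge0 ?invr_ge0 ?sqr_ge0// ltW.
(* The far contribution e D is then at most eta / 2; [D + 1] avoids dividing by zero. *)
pose e := Num.min e0 (eta / 2 / (D + 1)).
have D10 : 0 < D + 1 by rewrite ltr_wpDl.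
have e_gt0 : 0 < e by rewrite lt_min e00/= !divr_gt0.
have ei0 : 0 < e^-1 by rewrite invr_gt0.
have ee0 : 0 < e <= e0 by rewrite e_gt0/= ge_min lexx.
have [ik kE] := @integrable_cauchy_rV R d e^-1 x ei0.
have im j := @integrable_mixed_cauchy e^-1 x j ei0.
pose k1 := f x + eta / 2 / pi ^+ d.
pose k2 := M * (e * (1 + delta ^- 2)).
have i1 : L.-integrable setT (EFin \o (fun y => k1 * cauchy_rV e^-1 x y)).
  by have := integrableZl measurableT k1 ik; apply: eq_integrable.
have isum : L.-integrable setT (EFin \o (fun y => \sum_j mixed_cauchy e^-1 x y j)).
  have := @integrable_sum _ _ _ L setT measurableT 'I_d (index_enum 'I_d) xpredT
    (fun j y => (mixed_cauchy e^-1 x y j)%:E) (fun j _ => (im j).1).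
  by apply: eq_integrable => // y _; rewrite /= -sumEFin.
have i2 : L.-integrable setT (EFin \o (fun y => k2 * \sum_j mixed_cauchy e^-1 x y j)).
  by have := integrableZl measurableT k2 isum; apply: eq_integrable.
have sE : \int[L]_y (\sum_j mixed_cauchy e^-1 x y j) = d%:R * pi ^+ d.
  rewrite /Rintegral; under eq_integral do rewrite -sumEFin.
  rewrite (@integral_sum _ _ _ L setT measurableT 'I_d
    (fun j y => (mixed_cauchy e^-1 x y j)%:E) (fun j => (im j).1)).
  rewrite (eq_bigr (fun=> (pi ^+ d)%:E)).
    by rewrite sumEFin/= sumr_const card_ord mulr_natl.
  move=> j _; rewrite -(im j).2 /Rintegral fineK//.
  by apply: integrable_fin_num => //; exact: (im j).1.
apply: (le_trans (hB e ee0)).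
apply: (@le_trans _ _ (\int[L]_y (k1 * cauchy_rV e^-1 x y +
    k2 * \sum_j mixed_cauchy e^-1 x y j))).
  apply: le_Rintegral => //.
  - have := integrable_bounded_mul ik mf fb.
    by apply: eq_integrable => // y _; rewrite /= mulrC.
  - by have := integrableD measurableT i1 i2; apply: eq_integrable.
  move=> y _; have c0 := cauchy_rV_ge0 x y ei0.
  have s0 : 0 <= \sum_j mixed_cauchy e^-1 x y j.
    by apply: sumr_ge0 => j _; exact: mixed_cauchy_ge0.
  have k20 : 0 <= k2.
    by rewrite !mulr_ge0// ?addr_ge0 ?invr_ge0 ?sqr_ge0// ltW.
  have k10 : 0 <= k1 by rewrite addr_ge0 ?(ltW eta2)//; have /andP[] := fM x.
  have [yx|] := pselect (forall j, `|y ord0 j - x ord0 j| < delta).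
    apply: (@le_trans _ _ (k1 * cauchy_rV e^-1 x y)); last first.
      by rewrite lerDl mulr_ge0.
    rewrite ler_wpM2r//; apply: hdelta; split => // i j.
    by rewrite ord1 /ball/= distrC.
  move=> /existsNP[j /negP]; rewrite -leNgt => hj.
  apply: (@le_trans _ _ (k2 * \sum_j mixed_cauchy e^-1 x y j)); last first.
    by rewrite lerDr mulr_ge0.
  apply: (@le_trans _ _ (M * (e * (1 + delta ^- 2) * mixed_cauchy e^-1 x y j))).
    by rewrite ler_pM ?cauchy_rV_tail//; have /andP[] := fM y.
  rewrite mulrA ler_wpM2l//.
  rewrite (bigD1 j)//= lerDl; apply: sumr_ge0 => i _; exact: mixed_cauchy_ge0.
rewrite RintegralD// !RintegralZl// kE sE.
have he : e * (D + 1) <= eta / 2.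
  by rewrite -ler_pdivlMr// ge_min lexx orbT.
have -> : k2 * (d%:R * pi ^+ d) = e * D by rewrite /k2 /D; ring.
have -> : k1 * pi ^+ d = pi ^+ d * f x + eta / 2.
  by rewrite /k1; field; rewrite gt_eqF.
have := e_gt0; lra.
Qed.

Lemma prod_laplace_cauchy (e : R) (x y : V) : 0 < e ->
  \prod_i (2 * e / (e ^+ 2 + (y - x) ord0 i ^+ 2)) = 2 ^+ d * cauchy_rV e^-1 x y.
Proof.
move=> e0; have -> : 2 ^+ d = \prod_(i < d) 2 :> R by rewrite prodr_const card_ord.
rewrite /cauchy_rV -big_split/=.
apply: eq_bigr => i _; rewrite !mxE /oneDsqr.
set z := y ord0 i - x ord0 i.
have h : e ^+ 2 + z ^+ 2 != 0.
  by rewrite gt_eqF// ltr_pwDl ?sqr_ge0// exprn_gt0.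
have -> : 1 + (e^-1 * z) ^+ 2 = (e ^+ 2 + z ^+ 2) / e ^+ 2.
  by field; rewrite gt_eqF.
by field; rewrite h gt_eqF.
Qed.

End cauchy_approximation.

(** * The lower bound for the density *)

Section semigroup_density.
Context {R : realType} (d : nat).
Local Notation V := 'rV[R]_d.
Local Notation L := (lebesgue_rV d).
Variables (nu : {measure set V -> \bar R}) (P : R -> probability V R).
Hypothesis hP : levy_semigroup nu P.
Variables (t : R) (f : V -> R).
Hypotheses (t0 : 0 < t) (hf : is_density (P t) f).

(** The Fourier transform of P_t is real, so the sine term of cos(v.y - v.x) integrates to 0. *)
Lemma Rintegral_cos_levy (v x : V) :
  \int[P t]_y cos (dotp v (y - x)) =
  expR (- (t * levy_exponent nu v)) * cos (dotp v x).
Proof.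
have [_ /(_ t (ltW t0) v)] := hP.
rewrite /fourier => -[hc hs].
have ib (g : V -> R) : measurable_fun setT g -> (forall y, `|g y| <= 1) ->
    (P t).-integrable setT (EFin \o g).
  move=> mg g1.
  by apply: (@integrable_bounded _ _ _ (P t) _ g 1) => //; exact: fin_num_fun_lty.
have md : measurable_fun setT (fun y : V => dotp v y) by exact: measurable_dotp.
have ic : (P t).-integrable setT (EFin \o (fun y => cos (dotp v y))).
  by apply: ib => [|y]; [exact: measurable_cosT|exact: cos_max].
have is_ : (P t).-integrable setT (EFin \o (fun y => sin (dotp v y))).
  by apply: ib => [|y]; [exact: measurable_sinT|exact: sin_max].
transitivity (\int[P t]_y (cos (dotp v y) * cos (dotp v x) +
    sin (dotp v y) * sin (dotp v x))).
  by apply: eq_Rintegral => y _; rewrite dotpDr dotpNr cosB.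
rewrite RintegralD//; last 2 first.
- by have := integrableZr measurableT (cos (dotp v x)) ic; apply: eq_integrable.
- by have := integrableZr measurableT (sin (dotp v x)) is_; apply: eq_integrable.
by rewrite !RintegralZr// hc hs mul0r addr0 mulNr.
Qed.

(** Fubini moves the transform onto the weight, turning it into a Cauchy kernel centred at x that is
    integrated against P_t, hence against its density. *)
Lemma wft_levy_density (e : R) (x : V) : 0 < e ->
  wft L (laplace_rV e) (fun v => expR (- (t * levy_exponent nu v))) x =
  2 ^+ d * \int[L]_y (f y * cauchy_rV e^-1 x y).
Proof.
move=> e0; have [mf f0 fE] := hf.
have ei0 : 0 < e^-1 by rewrite invr_gt0.
pose h (z : V * V) := cos (dotp z.1 (z.2 - x)).
have mh : measurable_fun setT h.
  apply: measurable_cosT; apply: measurable_dotp => //.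
  apply: measurable_fun_rV => i; under eq_fun do rewrite !mxE.
  apply: measurable_funB => //.
  exact: (measurableT_comp (measurable_coord i)).
have h1 z : `|h z| <= 1 by exact: cos_max.
have := Rintegral_fubini_bounded (P t) mh h1 (@integrable_laplace_rV R d e e0).
rewrite /h/= => E.
transitivity (\int[L]_v (laplace_rV e v * \int[P t]_y cos (dotp v (y - x)))).
  by apply: eq_Rintegral => v _; rewrite Rintegral_cos_levy.
rewrite E.
transitivity (\int[P t]_y (2 ^+ d * cauchy_rV e^-1 x y)).
  apply: eq_Rintegral => y _.
  by rewrite Rintegral_laplace_rV_cos// prod_laplace_cauchy.
have mk : measurable_fun setT (cauchy_rV e^-1 x).
  have [ik _] := @integrable_cauchy_rV R d e^-1 x ei0.
  by apply/measurable_EFinP; exact: (measurable_int _ ik).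
have k0 y : 0 <= cauchy_rV e^-1 x y by exact: cauchy_rV_ge0.
rewrite /Rintegral (@ge0_integral_density _ _ _ (P t) L f mf f0 fE
  (fun y => 2 ^+ d * cauchy_rV e^-1 x y)).
- under eq_integral do rewrite mulrCA EFinM.
  rewrite ge0_integralZl//.
  (* If the integral were infinite, [fine] would return 0 on both sides. *)
  + have [foo|foo] := boolP ((\int[L]_y (f y * cauchy_rV e^-1 x y)%:E)%E \is a fin_num).
      by rewrite fineM.
    move: foo; rewrite fin_numEn => /orP[] /eqP ->.
      by rewrite mulrNy gtr0_sg ?exprn_gt0// mul1e mulr0.
    by rewrite mulry gtr0_sg ?exprn_gt0// mul1e mulr0.
  + by apply/measurable_EFinP; exact: measurable_funM.
  + by move=> y _; rewrite lee_fin mulr_ge0.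
- exact: measurable_funM.
- by move=> y; rewrite mulr_ge0.
Qed.

Lemma levy_density_ge (B : R) (x : V) (e0 : R) : bounded_fun f ->
  {for x, continuous f} -> 0 < e0 ->
  (forall e, 0 < e <= e0 ->
    B <= wft L (laplace_rV e) (fun v => expR (- (t * levy_exponent nu v))) x) ->
  B / (2 * pi) ^+ d <= f x.
Proof.
move=> [M [_ hM]] cf e00 hB; have [mf f0 fE] := hf.
have p2 : 0 < 2 ^+ d :> R by rewrite exprn_gt0.
have pid : 0 < pi ^+ d :> R by rewrite exprn_gt0// pi_gt0.
rewrite exprMn invfM mulrA ler_pdivrMr// [leRHS]mulrC.
(* [bounded_fun] gives a bound by every number strictly above [M], hence [M + 1]. *)
apply: (@cauchy_approx_le _ _ f (M + 1) _ x e0) => //.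
  move=> y; rewrite f0/= -[leLHS]ger0_norm//.
  by apply: (hM (M + 1)) => //; rewrite ltrDl.
move=> e ee0; rewrite ler_pdivrMr// mulrC.
have := hB e ee0; rewrite wft_levy_density//.
by case/andP: ee0.
Qed.

End semigroup_density.

(** * Contribution of a single large jump *)

Section lower_bounds.
Context {R : realType} (d : nat).
Local Notation V := 'rV[R]_d.
Local Notation L := (lebesgue_rV d).
Variable nu : {measure set V -> \bar R}.
Hypothesis hnu : levy_measure nu.

Lemma posdef_laplace (e : R) : 0 < e -> posdef L (laplace_rV e) (cst 1).
Proof.
move=> e0; split.
- by [].
- by exists 1 => v; rewrite normr1.
- move=> x; rewrite /wft; under eq_Rintegral do rewrite mul1r.
  rewrite Rintegral_laplace_rV_cos//; apply: prodr_ge0 => i _.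
  by rewrite divr_ge0 ?mulr_ge0 ?addr_ge0 ?sqr_ge0// ltW.
Qed.

Lemma eball_subset_far (r rho : R) (x : V) : r + rho <= enorm x ->
  eball x rho `<=` ~` eball 0 r.
Proof.
move=> rx y; rewrite /eball/= subr0 => yx; apply/negP; rewrite -leNgt.
have := enormD_le y (- (y - x)); rewrite opprB addrC subrK => h.
by rewrite -opprB enormN in yx *; move: yx h rx; rewrite ?enormN; lra.
Qed.

Lemma levy_part_le (D : set V) v : measurable D -> (nu D < +oo)%E ->
  levy_part nu D v <= 2 * fine (nu D).
Proof.
move=> mD nuD; rewrite (levy_partE mD nuD).
have := @norm_cosft R d (mfrestr mD nuD) v.
rewrite /= /mfrestr /mrestr setTI ler_norml => /andP[h _].
lra.
Qed.

(** Split exp(-t Phi) at jump size r and keep the first order term of the large-jump exponential. By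
    [wftM_cosft] its transform at x averages that of the small-jump multiplier over x + y and x - y,
    for y distributed as the large jumps. For y in the ball around x, which consists of large jumps
    since r + rho <= |x|, the point x - y lies near the origin. *)
Lemma wft_large_jump (e t r rho c : R) (x : V) : 0 < e -> 0 <= t -> 0 < r ->
  0 <= c -> r + rho <= enorm x ->
  (forall z, enorm z <= rho -> c <= wft L (laplace_rV e)
    (fun v => expR (- (t * levy_part nu (eball 0 r) v))) z) ->
  expR (- (t * fine (nu (~` eball 0 r)))) * t * (c / 2) *
    fine (nu (eball x rho)) <=
  wft L (laplace_rV e) (fun v => expR (- (t * levy_exponent nu v))) x.
Proof.
move=> e0 t0 r0 c_ge0 rx hc.
have iw := @integrable_laplace_rV R d e e0.
have mB := @measurable_eball R d 0 r.
have mD : measurable (~` eball (0 : V) r) by exact: measurableC.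
have nuD := levy_tail_lty hnu r0.
pose mu : {finite_measure set V -> \bar R} := mfrestr mD nuD.
pose g v := expR (- (t * levy_part nu (eball 0 r) v)).
pose lam := fine (nu (~` eball 0 r)).
have pg : posdef L (laplace_rV e) g.
  exact: (posdef_levy hnu iw (posdef_laplace e0)).
have [mg [Bg gB] g0] := pg.
have -> : (fun v => expR (- (t * levy_exponent nu v))) =
    (fun v => expR (- (t * lam)) * (g v * expR (t * cosft mu v))).
  apply/funext => v; rewrite (levy_exponentE hnu v mB) (levy_partE mD nuD).
  by rewrite /g -!expRD; congr expR; rewrite -/lam -/mu; ring.
have pge := posdef_expM iw mu t0 pg.
have [mge [B geB] _] := pge.
rewrite (wftZ iw _ x mge geB) -!mulrA ler_wpM2l ?expR_ge0//.
apply: le_trans (wft_expM_ge iw mu x t0 pg).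
rewrite ler_wpM2l//.
have [ih ->] := wftM_cosft iw mu x mg gB.
have mBx := @measurable_eball R d x rho.
have -> : fine (nu (eball x rho)) = \int[mu]_y \1_(eball x rho) y.
  rewrite /Rintegral integral_indic// setIT /mu/= /mfrestr /mrestr setIidl//.
  exact: eball_subset_far.
have ii : mu.-integrable setT (EFin \o \1_(eball x rho)).
  apply: (@integrable_bounded _ _ _ mu _ _ 1) => //; first exact: fin_num_fun_lty.
  by move=> y; rewrite indicE; case: (_ \in _); rewrite ?normr1 ?normr0.
rewrite mulrA -RintegralZl//.
apply: le_Rintegral => //.
  by have := integrableZl measurableT (c / 2) ii; apply: eq_integrable.
move=> y _; rewrite indicE.
have h1 := g0 (x + y); have h2 := g0 (x - y).
case: (boolP (y \in _)) => [|_]; last first.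
  by rewrite mulr0 divr_ge0// addr_ge0.
rewrite inE /eball/= => yx; rewrite mulr1 ler_pM2r ?invr_gt0//.
(* The value at x + y is only known to be nonnegative; dropping it accounts for the factor 1/2 on
   [c]. *)
have : c <= wft L (laplace_rV e) g (x - y).
  by apply: hc; rewrite -enormN opprB ltW.
lra.
Qed.

End lower_bounds.

Theorem theorem2 (R : realType) (d : nat) (hd : (1 <= d)%N)
    (nu : {measure set 'rV[R]_d -> \bar R})
    (hnu : levy_measure nu) (hsym : symmetric_measure nu)
    (P : R -> probability 'rV[R]_d R) (hP : levy_semigroup nu P)
    (p : R -> 'rV[R]_d -> R)
    (hp : forall t : R, 0 < t ->
      [/\ is_density (P t) (p t), smooth (p t) & bounded_fun (p t)])
    (alpha : R) (halpha : 0 < alpha < 2)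
    (c0 : R) (hc0 : 0 < c0)
    (hPhi : forall xi : 'rV[R]_d, 1 < enorm xi ->
      c0 * enorm xi `^ alpha <= levy_exponent nu xi)
    (A : set 'rV[R]_d) (hA : measurable A)
    (gamma : R) (hgamma : 1 <= gamma <= d%:R)
    (c1 c2 : R) (hc1 : 0 < c1) (hc2 : 0 < c2)
    (q : R -> R)
    (hqm : measurable_fun (`]0, +oo[%classic : set (measurableTypeR R))
       (q : _ -> measurableTypeR R))
    (hqpos : forall r : R, 0 < r -> 0 < q r)
    (hqbd : exists M : R, forall r : R, 0 < r -> q r <= M)
    (hball : forall x : 'rV[R]_d, A x -> x != 0 -> forall r : R, 0 < r ->
      ((c1 * r `^ gamma * enorm x `^ (- alpha - gamma) * q (enorm x))%:E
        <= nu (eball x r))%E)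
    (htail : forall r : R, 0 < r < 1 ->
      (nu (~` eball 0 r) <= (c2 * r `^ (- alpha))%:E)%E) :
  exists2 C : R, 0 < C &
    forall x : 'rV[R]_d, A x -> forall t : R, 0 < t < 1 ->
      C * (if x == 0 then t `^ (- (d%:R / alpha))
           else Num.min (t `^ (- (d%:R / alpha)))
             (t `^ (1 + (gamma - d%:R) / alpha) * enorm x `^ (- alpha - gamma)
               * q (enorm x)))
        <= p t x.
Proof.
have /andP[a0 a2] := halpha.
(* Bound of t Phi on the cube of half-side 1/tau: [levy_exponent_le] with s^2 = d and r = tau. *)
pose S := (2 + d%:R) * tail_const alpha c2.
have [ca ca0 [rhoa rhoa0 Ha]] := @wft_near_diagonal R d alpha c0 0 S a0 hc0.
(* Jumps are cut at kappa tau. The bound 1/2 keeps this below 1, as the tail hypothesis requires;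
   the bound [rhoa / 2] leaves room for [rho]. *)
pose kappa := Num.min (rhoa / 2) (1 / 2).
have kappa0 : 0 < kappa by rewrite lt_min !divr_gt0.
pose Lam := c2 * kappa `^ (- alpha).
(* Discarding the jumps beyond kappa tau lowers t Phi by at most twice t times their mass, hence by
   at most 2 Lam. *)
have [cb cb0 [rhob rhob0 Hb]] :=
  @wft_near_diagonal R d alpha c0 (2 * Lam) S a0 hc0.
(* Below [rhob] for the near-diagonal bound; below [rhoa / 2] so that the ball of radius rho tau
   around any x with |x| > rhoa tau avoids the small jumps. *)
pose rho := Num.min rhob (rhoa / 2).
have rho0 : 0 < rho by rewrite lt_min rhob0 divr_gt0.
have krho : kappa + rho <= rhoa.
  rewrite [leRHS]splitr lerD//; first by rewrite ge_min lexx.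
  by rewrite ge_min lexx orbT.
have p2pi : 0 < (2 * pi) ^+ d :> R by rewrite exprn_gt0// mulr_gt0// pi_gt0.
pose Cb := expR (- Lam) * (cb / 2) * (c1 * rho `^ gamma).
have Cb0 : 0 < Cb by rewrite !mulr_gt0 ?expR_gt0 ?powR_gt0 ?divr_gt0.
have minC0 : 0 < Num.min ca Cb by rewrite lt_min ca0.
exists (Num.min ca Cb / (2 * pi) ^+ d); first by rewrite divr_gt0.
move=> x Ax t /andP[t0 t1].
have [pd ps pb] := hp t t0.
have cp : {for x, continuous (p t)}.
  (* For the empty sequence, [smooth] is differentiability of [p t] itself. *)
  exact: differentiable_continuous (ps [::] x).
pose tau := t `^ alpha^-1.
have tau0 : 0 < tau by rewrite powR_gt0.
have tauE : tau `^ alpha = t.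
  by rewrite /tau -powRrM mulVf ?gt_eqF// powRr1// ltW.
have tau1 : tau < 1.
  have := @gt0_ltr_powR R alpha^-1; rewrite invr_gt0 => /(_ a0 t 1).
  by rewrite !nnegrE powR1; apply; rewrite ?ltW.
have tau01 : 0 < tau < 1 by rewrite tau0.
have taudE : t `^ (- (d%:R / alpha)) = (tau ^+ d)^-1.
  by rewrite powRN mulrC powRrM powR_mulrn// powR_ge0.
have taugE : t `^ (1 + (gamma - d%:R) / alpha) = t * tau `^ gamma / tau ^+ d.
  rewrite powRD; last by rewrite (gt_eqF t0) implybT.
  rewrite powRr1 ?(ltW t0)// -mulrA; congr (_ * _).
  rewrite mulrC powRrM -/tau powRD; last by rewrite (gt_eqF tau0) implybT.
  by rewrite powRN powR_mulrn// ltW.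
have taud0 : 0 < tau ^+ d by rewrite exprn_gt0.
have Phi_low (v : 'rV[R]_d) : 1 < enorm v ->
    c0 * (tau * enorm v) `^ alpha <= t * levy_exponent nu v.
  move=> v1; rewrite powRM ?enorm_ge0 ?(ltW tau0)// tauE mulrCA ler_pM2l//.
  exact: hPhi.
have Phi_up (v : 'rV[R]_d) : (forall i, `|v ord0 i| <= tau^-1) ->
    t * levy_exponent nu v <= S.
  move=> hv.
  have vs : enorm v * tau <= Num.sqrt d%:R.
    rewrite -(@ler_pXn2r _ 2)// ?nnegrE ?sqrtr_ge0 ?mulr_ge0 ?enorm_ge0 ?(ltW tau0)//.
    rewrite sqr_sqrtr// exprMn sqr_enorm -ler_pdivlMr ?exprn_gt0//.
    rewrite -[X in X%:R]card_ord -sumr_const mulr_suml; apply: ler_sum => i _.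
    rewrite mul1r -expr2 -real_normK ?num_real// -exprVn lerXn2r ?nnegrE//.
    by rewrite invr_ge0 ltW.
  have := levy_exponent_le hnu halpha hc2 htail tau01 vs.
  rewrite sqr_sqrtr// -/S powRN tauE => h.
  by rewrite mulrC -ler_pdivlMr.
have Phi0 v : 0 <= t * levy_exponent nu v.
  (* [levy_exponent nu] is convertible to [levy_part nu setT]. *)
  by rewrite mulr_ge0 ?(ltW t0)//; exact: (levy_part_ge0 nu setT).
have mexp (D : set 'rV[R]_d) : measurable D ->
    measurable_fun setT (fun v => expR (- (t * levy_part nu D v))).
  move=> mD; have [] := posdef_levy hnu (@integrable_laplace_rV R d 1 ltr01)
    (posdef_laplace d ltr01) mD (ltW t0).
  by [].
(* For |x| <= rhoa tau, which includes x = 0, the full exponent satisfies the near-diagonal bound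
   and the claim follows from t^(-d/alpha) = tau^(-d). Beyond that, one large jump is used. *)
have [xnear|xfar] := leP (enorm x) (rhoa * tau).
  apply: (@le_trans _ _ (ca / tau ^+ d / (2 * pi) ^+ d)).
    rewrite mulrAC ler_pM2r ?invr_gt0// ler_pM ?(ltW minC0)//.
    - case: ifP => [_|/negbT x0]; first by rewrite powR_ge0.
      rewrite le_min powR_ge0/= !mulr_ge0 ?powR_ge0// ltW// hqpos//.
      rewrite lt_neqAle enorm_ge0 andbT eq_sym.
      by apply: contra_neq x0 => /enorm_eq0.
    - by rewrite ge_min lexx.
    - by rewrite -taudE; case: ifP => _ //; rewrite ge_min lexx.
  apply: (levy_density_ge hP t0 pd pb cp tau0) => e et.
  apply: Ha => //.
  - exact: (mexp setT measurableT).
  - by move=> v v1; rewrite subr0; exact: Phi_low.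
have x0 : x != 0.
  apply: contraTneq xfar => ->.
  by rewrite -leNgt /enorm dotp0r sqrtr0 mulr_ge0// ltW.
have ex0 : 0 < enorm x by rewrite (le_lt_trans _ xfar)// mulr_ge0// ltW.
rewrite (negbTE x0) taugE.
have kt0 : 0 < kappa * tau by rewrite mulr_gt0.
have kt1 : kappa * tau < 1.
  rewrite (lt_trans _ tau1)// gtr_pMl//.
  by rewrite gt_min; apply/orP; right; rewrite ltr_pdivrMr// mul1r ltr1n.
(* By the tail hypothesis at kappa tau, where (kappa tau)^(-alpha) = kappa^(-alpha) / t. *)
have tlam : t * fine (nu (~` eball 0 (kappa * tau))) <= Lam.
  have fin := levy_tail_lty hnu kt0.
  have := htail (kappa * tau); rewrite kt0 kt1 => /(_ isT) h.
  have : fine (nu (~` eball 0 (kappa * tau))) <= c2 * (kappa * tau) `^ (- alpha).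
    by rewrite -lee_fin fineK// ge0_fin_numE.
  rewrite powRM ?(ltW kappa0) ?(ltW tau0)// [tau `^ _]powRN tauE mulrA -/Lam.
  by rewrite ler_pdivlMr// mulrC.
have rx : kappa * tau + rho * tau <= enorm x.
  by rewrite -mulrDl (le_trans _ (ltW xfar))// ler_pM2r.
have mB := @measurable_eball R d 0 (kappa * tau).
have mBC : measurable (~` eball (0 : 'rV[R]_d) (kappa * tau)).
  exact: measurableC.
have nuB := hball x Ax x0 (rho * tau) (mulr_gt0 rho0 tau0).
have nuBE : c1 * (rho * tau) `^ gamma * enorm x `^ (- alpha - gamma) * q (enorm x)
    <= fine (nu (eball x (rho * tau))).
  rewrite -lee_fin fineK// ge0_fin_numE//.
  apply: le_lt_trans (levy_tail_lty hnu kt0).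
  apply: le_measure; rewrite ?inE//; first exact: measurable_eball.
  exact: eball_subset_far.
set N := fine (nu (eball x _)) in nuBE.
(* The minimum is bounded by its second argument, and the ball hypothesis at radius rho tau supplies
   the factor tau^gamma. *)
apply: (@le_trans _ _ (expR (- Lam) * t * (cb / tau ^+ d / 2) * N / (2 * pi) ^+ d)).
  rewrite mulrAC ler_pM2r ?invr_gt0//.
  have b0 : 0 <= t * tau `^ gamma / tau ^+ d * enorm x `^ (- alpha - gamma)
      * q (enorm x).
    by rewrite !mulr_ge0 ?powR_ge0 ?invr_ge0 ?(ltW t0) ?(ltW taud0)// ltW// hqpos.
  apply: (@le_trans _ _ (Cb * (t * tau `^ gamma / tau ^+ d *
      enorm x `^ (- alpha - gamma) * q (enorm x)))).
    rewrite ler_pM ?(ltW minC0)//.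
    - by rewrite le_min powR_ge0.
    - by rewrite ge_min lexx orbT.
    - by rewrite ge_min lexx orbT.
  have -> : Cb * (t * tau `^ gamma / tau ^+ d * enorm x `^ (- alpha - gamma)
      * q (enorm x)) = expR (- Lam) * t * (cb / tau ^+ d / 2) *
    (c1 * (rho * tau) `^ gamma * enorm x `^ (- alpha - gamma) * q (enorm x)).
    by rewrite powRM ?(ltW rho0) ?(ltW tau0)// /Cb; ring.
  rewrite ler_wpM2l// ltW// mulr_gt0 ?divr_gt0//.
  by rewrite mulr_gt0 ?expR_gt0.
apply: (levy_density_ge hP t0 pd pb cp tau0) => e et.
have /andP[e0 _] := et.
have hz z : enorm z <= rho * tau -> cb / tau ^+ d <= wft (lebesgue_rV d) (laplace_rV e)
    (fun v => expR (- (t * levy_part nu (eball 0 (kappa * tau)) v))) z.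
  move=> hz; apply: Hb => //.
  - exact: mexp.
  - by move=> v; rewrite mulr_ge0 ?levy_part_ge0// ltW.
  (* The small-jump exponent inherits the growth of Phi up to the loss 2 Lam. *)
  - move=> v v1; have := Phi_low v v1.
    rewrite (levy_exponentE hnu v mB).
    have := levy_part_le v mBC (levy_tail_lty hnu kt0).
    rewrite -(ler_pM2l t0) mulrCA => h1 h2.
    have h3 : 2 * (t * fine (nu (~` eball 0 (kappa * tau)))) <= 2 * Lam by rewrite ler_pM2l.
    rewrite mulrDr in h2; lra.
  - move=> v hv; apply: le_trans (Phi_up v hv).
    by rewrite ler_pM2l// (levy_exponentE hnu v mB) lerDl levy_part_ge0.
  - by rewrite (le_trans hz)// ler_pM2r// ge_min lexx.
have ctau0 : 0 <= cb / tau ^+ d by rewrite divr_ge0 ?ltW.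
apply: le_trans (wft_large_jump hnu e0 (ltW t0) kt0 ctau0 rx hz).
rewrite -/N.
have N0 : 0 <= N by rewrite fine_ge0.
rewrite ler_wpM2r//.
have cb2 : 0 <= cb / tau ^+ d / 2 by rewrite divr_ge0.
by rewrite (ler_wpM2r cb2)// (ler_wpM2r (ltW t0))// ler_expR lerN2.
Qed.
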